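(* Let $H$ be an infinite dimensional complex Hilbert space and let $T \in \overline{\mathcal{AN}(H)}$ be a $\ast$-paranormal operator. If $\dim N(T) = \dim N(T^* )$, then $T$ is normal.
   Context: $N(\cdot)$ denotes the null space. An operator $T \in \mathcal{B}(H)$ (bounded linear operators on $H$) is absolutely norm attaining, written $T \in \mathcal{AN}(H)$, if for every nonzero closed subspace $L$ of $H$ there is a unit vector $x \in L$ with $\|Tx\| = \|T|_L\|$. $\overline{\mathcal{AN}(H)}$ is the closure of $\mathcal{AN}(H)$ in the operator norm. $T$ is $\ast$-paranormal if $\|T^*x\|^2 \leq \|T^2x\|\,\|x\|$ for all $x \in H$. *)

(* Defs.v *)
From HB Require Import structures.
From mathcomp Require Import all_boot all_order all_algebra complex.
From mathcomp Require Import all_classical all_reals topology normedtype.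

Set Implicit Arguments.
Unset Strict Implicit.
Unset Printing Implicit Defensive.

Import Order.TTheory GRing.Theory Num.Theory.
Import numFieldNormedType.Exports.

Local Open Scope classical_set_scope.
Local Open Scope ring_scope.
Local Open Scope card_scope.

(* Complex Hilbert spaces. The form is linear in its first argument and
   conjugate-linear in its second one. The norm of a normed module over R[i]
   takes its values in R[i] (they are real and nonnegative). *)
HB.mixin Record isHilbert (R : realType) (H : Type)
    of CompleteNormedModule R[i] H := {
  inner : {dot H for Num.conj};
  sqr_norm_inner : forall x : H, `|x| ^+ 2 = inner x x
}.

#[short(type="hilbertType")]
HB.structure Definition Hilbert (R : realType) :=
  {H of isHilbert R H & CompleteNormedModule R[i] H}.

Section Hilbert_theory.
Context {R : realType} {H : hilbertType R}.
Implicit Types (T S : {linear H -> H}) (L M N B : set H).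

Definition infinite_dimensional (V : lmodType R[i]) : Prop :=
  ~ exists (n : nat) (v : 'I_n -> V),
      forall x, exists c : 'I_n -> R[i], x = \sum_(i < n) c i *: v i.

Definition subspace_set L : Prop :=
  L 0 /\ (forall (a : R[i]) x y, L x -> L y -> L (a *: x + y)).

(* See linear_boundedP for the formulation |T x| <= r |x|. *)
Definition bounded_operator T : Prop := bounded_near T (nbhs (0 : H)).

(* The norm of the restriction to L of a bounded operator; complex.Re only
   casts the norm from R[i] to R, where suprema are available. *)
Definition opnorm_on (T : H -> H) L : R :=
  sup [set complex.Re `|T x| | x in L `&` [set x | `|x| <= 1]].

Definition opnorm (T : H -> H) : R := opnorm_on T setT.

(* The vector z with <T x, y> = <x, z> for all x; for a bounded operator T it
   exists by the Riesz representation theorem, and it is unique. *)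
Definition adjoint (T : H -> H) (y : H) : H :=
  xget 0 [set z | forall x, inner (T x) y = inner x z].

Definition null_space (T : H -> H) : set H := [set x | T x = 0].

Definition absolutely_norm_attaining T : Prop :=
  bounded_operator T /\
  forall L, subspace_set L -> closed L -> (exists2 x, L x & x != 0) ->
    exists x, [/\ L x, `|x| = 1 & complex.Re `|T x| = opnorm_on T L].

Definition AN_closure T : Prop :=
  bounded_operator T /\
  forall e : R, 0 < e ->
    exists2 S, absolutely_norm_attaining S & opnorm (T \- S) < e.

Definition star_paranormal T : Prop :=
  forall x, `|adjoint T x| ^+ 2 <= `|T (T x)| * `|x|.

Definition normal_operator T : Prop :=
  T \o adjoint T =1 adjoint T \o T.

Definition lin_span B : set H :=
  [set x | exists (n : nat) (v : 'I_n -> H) (c : 'I_n -> R[i]),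
    (forall i, B (v i)) /\ x = \sum_(i < n) c i *: v i].

Definition orthonormal_basis M B : Prop :=
  [/\ B `<=` M,
      forall x, B x -> `|x| = 1,
      forall x y, B x -> B y -> x <> y -> inner x y = 0 &
      M `<=` closure (lin_span B)].

(* Equality of Hilbert dimensions of closed subspaces, as cardinals. *)
Definition same_hilbert_dim M N : Prop :=
  exists B B', [/\ orthonormal_basis M B, orthonormal_basis N B' & B #= B'].

End Hilbert_theory.

Arguments infinite_dimensional {R} V.

(* Main.v *)
(* The Gram operator T*T of an operator in the closure of AN(H) is a scalar [g]
   plus a compact operator; what is used is that for every [e > 0] some finite
   set of vectors has an orthogonal complement on which
   [(g - e) |x|^2 <= |T x|^2 <= (g + e) |x|^2].  Otherwise one picks low
   and high directions greedily and obtains a closed subspace on which the norm of a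
   nearby AN operator is not attained.

   *-paranormality gives [|T x|^3 <= |T^3 x| |x|^2], hence by AM-GM the forms
   [b_u x = |T^2 x|^2 + u |T x|^2 - 2 u^2 |x|^2] satisfy
   [b_u (T x) >= u b_u x] for every [u >= 0].  Let [M] be the orthogonal
   complement of the union of all subspaces that reduce [T] to a normal
   operator.  For [u > g] ([u < g]) the form [b_u] is negative (positive) definite up to
   finitely many dimensions.  If it were not semidefinite on [M], moving [u]
   towards [g] from a value where it is would reach a semidefinite form with a
   nonzero finite-dimensional kernel.  This kernel is invariant under [T]
   (under its inverse), so [T] is bijective on it; there the recurrence
   [v_{n+2} + v_{n+1} = 2 v_n] for [v_n = |T^n x|^2 / u^n]
   makes [T] a multiple of an isometry, and *-paranormality then makes the kernel reducing and [T]
   normal on it, a contradiction.  Hence [b_g = 0] on [M], so [T] is normal on [M] as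
   well, and [M = 0].  Surjectivity of [T] on [M] for [g > 0] comes from the
   equality of the (then finite) dimensions of the two kernels, which together
   with ker T in ker T^* yields ker T = ker T^*. *)
From HB Require Import structures.
Require Import Defs.
From mathcomp Require Import all_boot all_order all_algebra complex.
From mathcomp Require Import all_classical all_reals topology normedtype.
From mathcomp Require Import finmap ring lra.

Set Implicit Arguments.
Unset Strict Implicit.
Unset Printing Implicit Defensive.

Import Order.TTheory GRing.Theory Num.Theory.
Import numFieldNormedType.Exports.

Local Open Scope ring_scope.

(** * Real Hilbert spaces and coercive forms *)

(** The order arguments concern real quadratic forms, so they are carried out over the reals, with
    completeness expressed by squared norms. *)
Record realHilbert (R : realType) := RealHilbert {
  rh_sort :> lmodType R;
  ip : rh_sort -> rh_sort -> R;
  ipC : forall x y, ip x y = ip y x;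
  ipDl : forall x y z, ip (x + y) z = ip x z + ip y z;
  ipZl : forall a x y, ip (a *: x) y = a * ip x y;
  ip_gt0 : forall x, x != 0 -> 0 < ip x x;
  ip_complete : forall u : nat -> rh_sort,
    (forall e, 0 < e -> exists N, forall m n, (N <= m)%N -> (N <= n)%N ->
      ip (u m - u n) (u m - u n) < e) ->
    exists l, forall e, 0 < e -> exists N, forall n, (N <= n)%N ->
      ip (u n - l) (u n - l) < e }.

Section Forms.
Context {R : realType} {V : realHilbert R}.
Implicit Types (x y z : V) (a t e : R) (B : V -> V -> R) (L M : V -> Prop).

Definition sq x : R := ip x x.

Record symform B : Prop := SymForm {
  sfC : forall x y, B x y = B y x;
  sfDl : forall x y z, B (x + y) z = B x z + B y z;
  sfZl : forall a x y, B (a *: x) y = a * B x y;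
  sf_bound : exists2 C : R, 0 <= C & forall x, B x x <= C * sq x }.

Definition is_subspace L :=
  [/\ L 0, forall x y, L x -> L y -> L (x + y) &
      forall a x, L x -> L (a *: x)].

Definition sqclosed L :=
  forall x, (forall e, 0 < e -> exists2 y, L y & sq (x - y) < e) -> L x.

Definition psd B M := forall x, M x -> 0 <= B x x.

Definition coercive B M :=
  exists2 c : R, 0 < c & forall x, M x -> c * sq x <= B x x.

Lemma sq_ge0 x : 0 <= sq x.
Proof.
have [->|/ip_gt0/ltW //] := eqVneq x 0.
by rewrite /sq -(scale0r (0 : V)) ipZl mul0r.
Qed.

Lemma sq_eq0 x : sq x <= 0 -> x = 0.
Proof. by have [//|/ip_gt0] := eqVneq x 0; rewrite ltNge => /negP. Qed.

Lemma ip_symform : symform (@ip _ V).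
Proof.
split; [exact: ipC|exact: ipDl|exact: ipZl|].
by exists 1 => // x; rewrite mul1r.
Qed.

Section OneForm.
Variables (B : V -> V -> R) (hB : symform B).

Lemma sfDr x y z : B x (y + z) = B x y + B x z.
Proof. by rewrite sfC // sfDl // (sfC hB y) (sfC hB z). Qed.

Lemma sfZr a x y : B x (a *: y) = a * B x y.
Proof. by rewrite sfC // sfZl // sfC. Qed.

Lemma sfNl x y : B (- x) y = - B x y.
Proof. by rewrite -scaleN1r sfZl // mulN1r. Qed.

Lemma sfNr x y : B x (- y) = - B x y.
Proof. by rewrite sfC // sfNl sfC. Qed.

Lemma sf0l x : B 0 x = 0.
Proof. by rewrite -(scale0r (0 : V)) sfZl // mul0r. Qed.

Lemma sf0r x : B x 0 = 0.
Proof. by rewrite sfC // sf0l. Qed.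

Lemma sf_addZ t x y :
  B (x + t *: y) (x + t *: y) = B x x + 2 * t * B x y + t ^+ 2 * B y y.
Proof.
rewrite !(sfDl hB, sfDr, sfZl hB, sfZr) (sfC hB y x); ring.
Qed.

Lemma sf_add x y : B (x + y) (x + y) = B x x + 2 * B x y + B y y.
Proof. by rewrite !(sfDl hB, sfDr) (sfC hB y x); ring. Qed.

Lemma sf_sub x y : B (x - y) (x - y) = B x x - 2 * B x y + B y y.
Proof. by rewrite !(sfDl hB, sfDr, sfNl, sfNr) (sfC hB y x); ring. Qed.

End OneForm.

Lemma null_sequence : exists r : nat -> R, (forall n, 0 < r n) /\
  forall e, 0 < e -> exists N, forall n, (N <= n)%N -> r n < e.
Proof.
exists (fun n => n.+1%:R^-1); split=> [n|e e0]; first by rewrite invr_gt0.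
have /archi_boundP h : 0 <= e^-1 by rewrite invr_ge0 ltW.
exists (Num.bound e^-1) => n hn.
rewrite -[e]invrK ltf_pV2 ?posrE ?invr_gt0 //.
by apply: (lt_le_trans h); rewrite ler_nat (leq_trans hn).
Qed.

Lemma quad_disc (a b c : R) : 0 <= c ->
  (forall t, 0 <= a + 2 * t * b + t ^+ 2 * c) -> b ^+ 2 <= a * c.
Proof.
move=> c0 h; have [c_gt0|] := ltP 0 c; last first.
  move=> cle; have {cle}c0 : c = 0 by apply/eqP; rewrite eq_le cle.
  subst c; rewrite mulr0; have [->|b0] := eqVneq b 0; first by rewrite expr0n.
  (* With [c = 0] the expression is affine in [t], and this [t] gives it the value -1. *)
  have := h (- (a + 1) / (2 * b)).
  have -> : a + 2 * (- (a + 1) / (2 * b)) * b + (- (a + 1) / (2 * b)) ^+ 2 * 0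
     = - 1 by field.
  lra.
have := h (- b / c).
have -> : a + 2 * (- b / c) * b + (- b / c) ^+ 2 * c = a - b ^+ 2 / c.
  by field; rewrite gt_eqF.
by rewrite subr_ge0 ler_pdivrMr.
Qed.

Lemma psd_CS B M x y : symform B -> is_subspace M -> psd B M -> M x -> M y ->
  B x y ^+ 2 <= B x x * B y y.
Proof.
move=> hB [_ MD MZ] Bp Mx My; apply: quad_disc => [|t]; first exact: Bp.
by rewrite -sf_addZ //; apply: Bp; apply: MD => //; apply: MZ.
Qed.

Lemma psd_ker B M z y : symform B -> is_subspace M -> psd B M -> M z -> M y ->
  B z z = 0 -> B z y = 0.
Proof.
move=> hB hM Bp Mz My Bz; have := psd_CS hB hM Bp Mz My.
by rewrite Bz mul0r => h; apply/eqP; rewrite -sqrf_eq0 eq_le h sqr_ge0.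
Qed.

Lemma subspaceT : is_subspace (fun _ : V => True). Proof. by []. Qed.

Lemma subspaceB L x y : is_subspace L -> L x -> L y -> L (x - y).
Proof.
by move=> [_ LD LZ] Lx Ly; apply: LD => //; rewrite -scaleN1r; apply: LZ.
Qed.

Lemma CS x y : ip x y ^+ 2 <= sq x * sq y.
Proof.
apply: (psd_CS ip_symform subspaceT) => // z _; exact: sq_ge0.
Qed.

Lemma sq_addle x y : sq (x + y) <= 2 * sq x + 2 * sq y.
Proof.
have := sq_ge0 (x - y).
by rewrite /sq (sf_sub ip_symform) (sf_add ip_symform); lra.
Qed.

Lemma sqZ a x : sq (a *: x) = a ^+ 2 * sq x.
Proof. by rewrite /sq ipZl ipC ipZl mulrA. Qed.

Lemma sqN x : sq (- x) = sq x.
Proof. by rewrite -scaleN1r sqZ sqrrN expr1n mul1r. Qed.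

Lemma sq0 : sq (0 : V) = 0. Proof.
  by rewrite -(scale0r (0 : V)) sqZ expr0n mul0r. Qed.

(* [p] minimizes [B p p - 2 f p] over [L]. *)
Lemma riesz_coercive B L (f : V -> R) (K : R) : 0 <= K -> symform B ->
  is_subspace L ->
    sqclosed L -> coercive B L ->
    (forall x y, f (x + y) = f x + f y) -> (forall a x, f (a *: x) = a * f x) ->
    (forall x, L x -> f x ^+ 2 <= K * sq x) ->
  exists2 p, L p & forall y, L y -> B p y = f y.
Proof.
move=> K0 hB hL Lcl [c c0 Bc] fD fZ fK.
have [L0 LD LZ] := hL; have [C C0 BC] := sf_bound hB.
have Bp : psd B L.
  by move=> x Lx; apply: le_trans (Bc _ Lx); rewrite mulr_ge0 ?sq_ge0 ?ltW.
pose J x := B x x - 2 * f x.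
have Jlb x : L x -> - (K / c) <= J x.
  move=> Lx; have h1 := fK _ Lx; have h2 := Bc _ Lx; have s0 := sq_ge0 x.
  have h3 : f x ^+ 2 <= (K / c) * B x x.
    apply: (le_trans h1); rewrite mulrAC ler_pdivlMr // -mulrA.
    by rewrite ler_wpM2l // mulrC.
  have Bx := Bp _ Lx.
  have k0 : 0 <= K / c by rewrite divr_ge0 // ltW.
  rewrite /J; move: h3 k0; move: (K / c) => k h3 k0.
  have : 2 * f x <= B x x + k; last by lra.
  by apply: (le_trans (ler_norm _)); rewrite -ler_sqr ?nnegrE ?addr_ge0 //
    real_normK ?num_real //; have := sqr_ge0 (B x x - k); nra.
pose S := [set J x | x in [set x | L x]]%classic.
have Slb : has_inf S.
  split; first by exists (J 0), 0.
  by exists (- (K / c)) => _ [x Lx <-]; exact: Jlb.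
pose d := inf S.
have dle x : L x -> d <= J x.
  by move=> Lx; apply: ge_inf; [case: Slb|exists x].
have [r [r0 rlt]] := null_sequence.
have /choice[u uP] : forall n : nat, exists x, L x /\ J x < d + r n.
  move=> n; have [|_ [x Lx <-] h] := @inf_adherent _ S (r n) _ Slb.
    exact: r0.
  by exists x.
clearbody d.
have uL n : L (u n) by case: (uP n).
have uJ n : J (u n) <= d + r n by apply/ltW; case: (uP n).
(* [u n] minimizes [J] up to [r n], so [J (u n + t *: y) - J (u n) + r n] is a nonnegative
   polynomial in [t]; its discriminant bounds the defect in [B p y = f y]. *)
have ucs n y : L y -> (B (u n) y - f y) ^+ 2 <= r n * B y y.
  move=> Ly; apply: quad_disc => [|t]; first exact: Bp.
  have := dle _ (LD _ _ (uL n) (LZ t _ Ly)).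
  rewrite /J sf_addZ // fD fZ => h; have := uJ n; rewrite /J; lra.
(* Parallelogram identity: at the midpoint of [u m] and [u n], [J] is still at least [d]. *)
have ucauchy m n : c * sq (u m - u n) <= 2 * (r m + r n).
  apply: (le_trans (Bc _ (subspaceB hL (uL m) (uL n)))).
  have := dle _ (LZ 2^-1 _ (LD _ _ (uL m) (uL n))).
  rewrite /J sf_sub // sfZl // sfZr // fZ fD sf_add //.
  have := uJ m; have := uJ n; rewrite /J; lra.
have [|p up] := @ip_complete _ V u.
  move=> e e0; have [|N hN] := rlt (c * e / 4).
    by rewrite divr_gt0 // mulr_gt0.
  exists N => m n /hN hm /hN hn; have := ucauchy m n; rewrite -/(sq _) => h.
  rewrite -(ltr_pM2l c0); lra.
have Lp : L p.
  apply: Lcl => e e0; have [N hN] := up _ e0.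
  by exists (u N) => //; rewrite -sqN opprB; apply: hN.
exists p => // y Ly; apply/eqP; rewrite -subr_eq0 -sqrf_eq0 eq_le sqr_ge0 andbT.
apply/ler_addgt0Pl => e e0; rewrite addr0.
have By := Bp _ Ly.
have b1 : 0 < B y y + 1 by lra.
have [|N1 h1] := rlt (e / (4 * (B y y + 1))).
  by rewrite divr_gt0 // mulr_gt0.
have [|N2 h2] := up (e / (4 * (C + 1) * (B y y + 1))).
  by rewrite divr_gt0 // !mulr_gt0 //; lra.
pose n := maxn N1 N2.
have {}h1 := h1 n (leq_maxl _ _); have {}h2 := h2 n (leq_maxr _ _).
have k1 : (B (u n) y - f y) ^+ 2 <= e / 4.
  apply: (le_trans (ucs n y Ly)).
  have -> : e / 4 = e / (4 * (B y y + 1)) * (B y y + 1).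
    by field; rewrite gt_eqF.
  by apply: ler_pM => //; [exact/ltW/r0|exact/ltW|rewrite lerDl].
have k2 : B (u n - p) y ^+ 2 <= e / 4.
  apply: (le_trans (psd_CS hB hL Bp (subspaceB hL (uL n) Lp) Ly)).
  have -> : e / 4 = (C + 1) * (e / (4 * (C + 1) * (B y y + 1))) * (B y y + 1).
    by field; rewrite !gt_eqF //; lra.
  apply: ler_pM => //; [| |by rewrite lerDl].
    exact: Bp (subspaceB hL (uL n) Lp).
  apply: (le_trans (BC _)); apply: ler_pM => //;
    [exact: sq_ge0|by rewrite lerDl|exact: ltW].
have -> : B p y - f y = (B (u n) y - f y) - B (u n - p) y.
  by rewrite sfDl // sfNl //; ring.
move: k1 k2; set a := B (u n) y - f y; set b := B (u n - p) y.
have := sqr_ge0 (a + b); rewrite !expr2; lra.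
Qed.

End Forms.

(** * Finite codimension *)

(* A vanishing combination of [n.+1] rows, read from its first nonzero
   coefficient on. *)
Lemma kernel_row (K : fieldType) n (A : nat -> 'I_n -> K) :
  exists j m (c : nat -> K), [/\ c 0%N != 0, (j + m)%N = n &
    forall k, \sum_(i < m.+1) c i * A (j + i)%N k = 0].
Proof.
pose M : 'M[K]_(n.+1, n) := \matrix_(i, k) A i k.
have : kermx M != 0.
  rewrite -mxrank_eq0 mxrank_ker -lt0n subn_gt0 ltnS; exact: rank_leq_col.
case/rowV0Pn => d /sub_kermxP dM d0.
pose c i := if (i < n.+1)%N then d 0 (inord i) else 0.
have cd (i : 'I_n.+1) : c i = d 0 i by rewrite /c ltn_ord inord_val.
have exc : exists i, c i != 0.
  have [i di|h] := pickP (fun i : 'I_n.+1 => d 0 i != 0).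
    by exists i; rewrite cd.
  case/eqP: d0; apply/rowP => i; rewrite mxE; apply/eqP.
  by have := h i; rewrite /= => /negbFE.
pose j := ex_minn exc.
have [cj jmin] : c j != 0 /\ forall i, c i != 0 -> (j <= i)%N.
  by rewrite /j; case: ex_minnP.
have jn : (j < n.+1)%N by move: cj; rewrite /c; case: ifP; rewrite ?eqxx.
exists j, (n - j)%N, (fun i => c (j + i)%N); split;
  rewrite ?addn0 ?subnKC // => k.
have /matrixP/(_ 0 k) := dM; rewrite !mxE => dMk.
transitivity (\sum_(i < n.+1) c i * A i k); last first.
  by rewrite -[RHS]dMk; apply: eq_bigr => i _; rewrite cd mxE.
rewrite -(big_mkord xpredT (fun i => c i * A i k)).
rewrite (big_cat_nat (n := j)) //=; last by rewrite ltnW.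
rewrite big_nat [X in _ = X + _]big1 ?add0r; last first.
  move=> i /andP[_ ij]; suff -> : c i = 0 by rewrite mul0r.
  by apply/eqP/negPn/negP => /jmin; rewrite leqNgt ij.
rewrite -[X in \sum_(X <= _ < _) _]add0n big_addn subSn // big_mkord.
by apply: eq_bigr => i _; rewrite addnC.
Qed.

Section Subspaces.
Context {R : realType} {V : realHilbert R}.
Implicit Types (x y z v : V) (a t e : R) (B : V -> V -> R) (L M E : V -> Prop).
Implicit Types (vs : seq V).

Definition orthto vs x := forall v, v \in vs -> ip x v = 0.

Lemma ip0l v : ip 0 v = 0. Proof. exact: (sf0l (@ip_symform R V)). Qed.

Lemma ip_suml n (F : 'I_n -> V) v :
  ip (\sum_(i < n) F i) v = \sum_(i < n) ip (F i) v.
Proof. by rewrite (big_morph (fun x => ip x v) (fun x y => ipDl x y v) (ip0l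
  v)). Qed.

Lemma sqclosed_zero (g : V -> R) (C : R) : 0 <= C -> (forall x, 0 <= g x) ->
  (forall x y, g y = 0 -> g x <= C * sq (x - y)) ->
  sqclosed (fun x => g x = 0).
Proof.
move=> C0 g0 gC x hx; apply/eqP; rewrite eq_le g0 andbT.
apply/ler_addgt0Pl => e e0; rewrite addr0.
have C1 : 0 < C + 1 by lra.
have [|y gy hy] := hx (e / (C + 1)); first by rewrite divr_gt0.
apply: (le_trans (gC x y gy)).
rewrite ltr_pdivlMr // in hy; have := sq_ge0 (x - y); nra.
Qed.

Lemma sqclosed_orth v : sqclosed (fun x => ip x v = 0).
Proof.
have h : sqclosed (fun x => ip x v ^+ 2 = 0).
  apply: (@sqclosed_zero _ (sq v)) => [|x|x y /eqP];
    [exact: sq_ge0|exact: sqr_ge0|].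
  rewrite sqrf_eq0 => /eqP yv.
  have -> : ip x v = ip (x - y) v.
    by rewrite ipDl (sfNl ip_symform) yv subr0.
  by rewrite mulrC; exact: CS.
move=> x hx; apply/eqP; rewrite -sqrf_eq0; apply/eqP;
  apply: h => e /hx[y yv xy].
by exists y; rewrite // yv expr0n.
Qed.

Lemma sqclosedI L M : sqclosed L -> sqclosed M ->
  sqclosed (fun x => L x /\ M x).
Proof.
move=> hL hM x hx; split; [apply: hL|apply: hM] => e /hx[y [Ly My] xy];
  by exists y.
Qed.

Lemma sqclosed_forall (I : Type) (L : I -> V -> Prop) :
  (forall i, sqclosed (L i)) -> sqclosed (fun x => forall i, L i x).
Proof. by move=> h x hx i; apply: h => e /hx[y Ly xy]; exists y. Qed.

Lemma subspace_orth v : is_subspace (fun x => ip x v = 0).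
Proof.
split=> [|x y xv yv|a x xv]; first exact: ip0l.
- by rewrite ipDl xv yv addr0.
- by rewrite ipZl xv mulr0.
Qed.

Lemma subspaceI L M : is_subspace L -> is_subspace M ->
  is_subspace (fun x => L x /\ M x).
Proof.
move=> [L0 LD LZ] [M0 MD MZ]; split=> // [x y [? ?] [? ?]|a x [? ?]].
- by split; [apply: LD|apply: MD].
- by split; [apply: LZ|apply: MZ].
Qed.

Lemma subspace_forall (I : Type) (L : I -> V -> Prop) :
  (forall i, is_subspace (L i)) -> is_subspace (fun x => forall i, L i x).
Proof.
move=> h; split=> [i|x y Lx Ly i|a x Lx i]; have [L0 LD LZ] := h i => //.
- exact: LD.
- exact: LZ.
Qed.

Lemma subspace_sum L n (F : 'I_n -> V) : is_subspace L -> (forall i, L (F i)) ->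
  L (\sum_(i < n) F i).
Proof. by move=> [L0 LD LZ] h; elim/big_ind: _. Qed.

(* One more dimension at a time: the [B]-orthogonal complement of a coercive
   hyperplane is a line, on which [B] either vanishes or is positive. *)
Lemma kernel_or_coercive B vs M : symform B -> is_subspace M -> sqclosed M ->
  psd B M -> coercive B (fun x => M x /\ orthto vs x) ->
  (exists z, [/\ M z, z != 0 & B z z = 0]) \/ coercive B M.
Proof.
move=> hB; elim: vs M => [|v vs IH] M hM Mcl Bp Bco.
  by right; case: Bco => c c0 h; exists c => // x Mx; apply: h.
pose M1 x := M x /\ ip x v = 0.
have hM1 : is_subspace M1 by apply: subspaceI => //; exact: subspace_orth.
have M1cl : sqclosed M1 by apply: sqclosedI => //; exact: sqclosed_orth.
have [||[z [[Mz _] z0 Bz]]|[c c0 Bc]] := IH M1 hM1 M1cl.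
- by move=> x [Mx _]; apply: Bp.
- case: Bco => c c0 h; exists c => // x [[Mx xv] hx]; apply: h; split=> //.
  by move=> w; rewrite in_cons => /orP[/eqP->|/hx].
- by left; exists z.
have [[u [Mu uv]]|nu] := pselect (exists u, M u /\ ip u v != 0); last first.
  right; exists c => // x Mx; apply: Bc; split=> //.
  by apply/eqP/negPn/negP => xv; apply: nu; exists x.
have [C C0 BC] := sf_bound hB.
(* [p] is the [B]-projection of [u] onto the hyperplane [M1], so [u - p] is [B]-orthogonal to
   [M1]. *)
have [|||||p [Mp pv] hp] :=
  @riesz_coercive _ _ B M1 (B u) (B u u * C) _ hB hM1 M1cl.
- by rewrite mulr_ge0 // Bp.
- by exists c.
- exact: sfDr.
- by move=> a x; exact: sfZr.
- move=> x [Mx _]; apply: (le_trans (psd_CS hB hM Bp Mu Mx)).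
  by rewrite -mulrA ler_wpM2l // Bp.
pose w := u - p.
have Mw : M w by apply: subspaceB.
have wv : ip w v != 0 by rewrite /w ipDl (sfNl ip_symform) pv subr0.
have w0 : w != 0 by apply: contraNneq wv => ->; rewrite ip0l.
have Bw y : M1 y -> B w y = 0.
  by move=> M1y; rewrite /w sfDl // sfNl // hp // subrr.
have [Bww|] := eqVneq (B w w) 0; first by left; exists w.
rewrite neq_lt ltNge Bp //= => b0; right.
have sw : 0 < sq w by exact: ip_gt0.
have [_ MD MZ] := hM.
(* The halving pays for [sq_addle]: the two components of [x] are [B]-orthogonal but need not be
   orthogonal. *)
exists (Num.min (B w w / sq w) c / 2).
  by rewrite divr_gt0 // lt_min divr_gt0.
move=> x Mx; pose t := ip x v / ip w v; pose y := x - t *: w.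
have M1y : M1 y.
  split; first by apply: subspaceB => //; apply: MZ.
  by rewrite /y ipDl (sfNl ip_symform) ipZl /t divfK // subrr.
have -> : x = y + t *: w by rewrite /y subrK.
rewrite sf_addZ // (sfC hB y w) (Bw y M1y) mulr0 addr0.
have h1 := Bc _ M1y; have := sq_addle y (t *: w); rewrite sqZ => h2.
have h3 : Num.min (B w w / sq w) c <= c by rewrite ge_min lexx orbT.
have h4 : Num.min (B w w / sq w) c * sq w <= B w w.
  by rewrite -ler_pdivlMr // ge_min lexx.
have h5 : 0 < Num.min (B w w / sq w) c by rewrite lt_min divr_gt0.
move: h3 h4 h5; set k := Num.min _ _ => h3 h4 h5.
have h6 : k * sq (y + t *: w) <= k * (2 * sq y + 2 * (t ^+ 2 * sq w)).
  by rewrite ler_pM2l.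
have h7 : k * sq y <= c * sq y by rewrite ler_wpM2r ?sq_ge0.
have h8 : t ^+ 2 * (k * sq w) <= t ^+ 2 * B w w.
  by rewrite ler_wpM2l ?sqr_ge0.
lra.
Qed.

(* At the last parameter where the form is positive semidefinite it cannot be
   coercive, so it has a kernel. *)
Lemma continuation (B : R -> V -> V -> R) M (a b K : R) : a <= b -> 0 <= K ->
    is_subspace M -> sqclosed M ->
    (forall t, a <= t <= b -> symform (B t)) ->
    (forall t, a <= t <= b ->
      exists vs, coercive (B t) (fun x => M x /\ orthto vs x)) ->
    (forall s t x, a <= s <= b -> a <= t <= b ->
      B t x x <= B s x x + K * `|s - t| * sq x) ->
    psd (B a) M ->
  (exists2 t, a <= t <= b &
     psd (B t) M /\ exists z, [/\ M z, z != 0 & B t z z = 0]) \/ psd (B b) M.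
Proof.
move=> ab K0 hM Mcl hB Bco BK Ba.
apply: contrapT => /not_orP[nker]; apply.
pose S := [set t | a <= t <= b /\ psd (B t) M]%classic.
have Sa : S a by rewrite /S /= lexx ab.
have Ssup : has_sup S.
  by split; [exists a|exists b => t [/andP[_ tb] _]].
pose s := sup S.
have sub t : S t -> t <= s by move=> St; apply: ub_le_sup => //; case: Ssup.
have has : a <= s <= b.
  rewrite sub //=; apply: ge_sup; first by exists a.
  by move=> t [/andP[]].
have sadh e : 0 < e -> exists2 t, S t & s - e < t by move=> e0;
  exact: sup_adherent.
clearbody s.
have Bs : psd (B s) M.
  move=> x Mx; apply/ler_addgt0Pr => e e0.
  have Ks : 0 <= K * sq x by rewrite mulr_ge0 ?sq_ge0.
  have k0 : 0 < K * sq x + 1 by lra.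
  have [|t St ts] := sadh (e / (K * sq x + 1)); first by rewrite divr_gt0.
  have [ht /(_ _ Mx) Bt] := St; have tles := sub _ St.
  have := BK s t x has ht; rewrite ger0_norm ?subr_ge0 // => h.
  have : (s - t) * (K * sq x + 1) < e by rewrite -ltr_pdivlMr //; lra.
  nra.
have [vs hvs] := Bco s has.
have [[z hz]|[c c0 Bc]] := kernel_or_coercive (hB s has) hM Mcl Bs hvs.
  by case: nker; exists s => //; split=> //; exists z.
have [as_ sb] := andP has.
have [sb'|bs] := ltP s b; last by have <- : s = b by apply/eqP;
  rewrite eq_le sb.
have K1 : 0 < K + 1 by lra.
(* Moving from [s] to [t] costs at most [K * (t - s) <= c], which coercivity at [s] absorbs; so
   [t > s] would belong to [S]. *)
pose t := Num.min b (s + c / (K + 1)).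
have st : s < t by rewrite lt_min sb' ltrDl divr_gt0.
suff /sub : S t by rewrite leNgt st.
have ht : a <= t <= b by rewrite (le_trans as_ (ltW st)) /t ge_min lexx.
split=> // x Mx.
have := BK t s x ht has; rewrite ger0_norm ?subr_ge0 ?(ltW st) // => h.
have h1 := Bc _ Mx; have h2 : (t - s) * (K + 1) <= c.
  rewrite -ler_pdivlMr // lerBlDl ge_min lexx orbT //.
have h3 : K * (t - s) <= c by nra.
have := ler_wpM2r (sq_ge0 x) h3; lra.
Qed.

(** There are fewer conditions than vectors. Since the combination starts at its first nonzero
    coefficient, its lowest term can be solved for. *)
Lemma dependency (y : nat -> V) vs : exists j m (c : nat -> R),
  c 0%N != 0 /\ orthto vs (\sum_(i < m.+1) c i *: y (j + i)%N).
Proof.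
have [j [m [c [c0 _ hc]]]] :=
  kernel_row (fun i (k : 'I_(size vs)) => ip (y i) (nth 0 vs k)).
exists j, m, c; split=> // v /(nthP 0)[k kn <-].
rewrite ip_suml -[RHS](hc (Ordinal kn)).
by apply: eq_bigr => i _; rewrite ipZl.
Qed.

(** * Linear maps on a finite-dimensional subspace *)

Section Invariance.
Variables (T : {linear V -> V}) (E : V -> Prop) (vs : seq V).
Hypothesis hE : is_subspace E.
Hypothesis Efin : forall x, E x -> orthto vs x -> x = 0.

Lemma iter_linear_sum n k (c : nat -> R) (y : nat -> V) :
  iter n T (\sum_(i < k) c i *: y i) = \sum_(i < k) c i *: iter n T (y i).
Proof.
elim: n => [//|n IH]; rewrite iterS IH linear_sum.
by apply: eq_bigr => i _; rewrite linearZ.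
Qed.

(** A dependency among the iterates [T^i x], freed of its common factor [T^j] by injectivity,
    expresses [x] through [T x], [T^2 x] and so on, that is, as an image. *)
Lemma fin_surjective : (forall x, E x -> E (T x)) ->
  (forall x, E x -> T x = 0 -> x = 0) ->
  forall x, E x -> exists2 y, E y & T y = x.
Proof.
move=> TE Tinj x Ex; have [_ ED EZ] := hE.
have [j [m [c [c0 hc]]]] := dependency (fun i => iter i T x) vs.
have Ei i : E (iter i T x) by elim: i => //= i; apply: TE.
have Ti i z : E z -> iter i T z = 0 -> z = 0.
  elim: i z => //= i IH z Ez h; apply: IH => //; apply: Tinj => //.
  by elim: {h} i => //= i; apply: TE.
have Esum k (f : nat -> R) : E (\sum_(i < k) f i *: iter i T x).
  by apply: subspace_sum => // i; apply: EZ.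
have := Efin _ hc.
have -> : \sum_(i < m.+1) c i *: iter (j + i) T x
    = iter j T (\sum_(i < m.+1) c i *: iter i T x).
  by rewrite iter_linear_sum; apply: eq_bigr => i _; rewrite iterD.
set z := \sum_(i < m.+1) c i *: iter i T x => h.
have Ez : E z by exact: Esum.
have Eiz i : E (iter i T z) by elim: i => //= i; apply: TE.
have : z = 0 by apply: (Ti j) => //; apply: h.
rewrite /z big_ord_recl /= => hx.
pose w := \sum_(i < m) c i.+1 *: iter i T x.
exists (- (c 0%N)^-1 *: w); first by apply: EZ;
  exact: (Esum m (fun i => c i.+1)).
rewrite linearZ /= linear_sum.
apply: (scalerI c0); rewrite scalerA mulrN divff // scaleN1r.
apply/eqP; rewrite eq_sym -addr_eq0 -[X in _ == X]hx; apply/eqP; congr (_ + _).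
by apply: eq_bigr => i _; rewrite linearZ.
Qed.

(** Preimages give a backward orbit [y i] of [x]. Applying [T^(j+1)] to a dependency of the
    [y (j + i)] leaves [T x] as a combination of the [y i]. *)
Lemma fin_invariant : (forall x, E x -> exists2 y, E y & T y = x) ->
  forall x, E x -> E (T x).
Proof.
move=> TE x Ex; have [E0 ED EZ] := hE.
have /choice[S ST] : forall z, exists y, E z -> E y /\ T y = z.
  move=> z; have [/TE[y Ey yz]|nEz] := pselect (E z); first by exists y.
  by exists 0 => /nEz.
pose y i := iter i S x.
have Ey i : E (y i) by elim: i => //= i /ST[].
have Ty i : T (y i.+1) = y i by have [] := ST _ (Ey i).
have Tiy i k : iter i T (y (i + k)%N) = y k.
  by elim: i => [//|i IH]; rewrite iterSr addSn Ty.
have [j [m [c [c0 hc]]]] := dependency y vs.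
have h0 : \sum_(i < m.+1) c i *: y (j + i)%N = 0.
  by apply: Efin => //; apply: subspace_sum => // i; apply: EZ.
have := congr1 (iter j.+1 T) h0.
have -> : iter j.+1 T 0 = 0 by elim: j.+1 => //= i ->; rewrite linear0.
rewrite (iter_linear_sum _ _ c (fun i => y (j + i)%N)) big_ord_recl /=.
rewrite Tiy => hx.
have -> : T x = - (c 0%N)^-1 *: \sum_(i < m) c i.+1 *: y i.
  apply: (scalerI c0); rewrite scalerA mulrN divff // scaleN1r.
  apply/eqP; rewrite -addr_eq0 -[X in _ == X]hx; apply/eqP; congr (_ + _).
  apply: eq_bigr => i _; congr (_ *: _).
  by rewrite -iterS -[RHS]/(iter j.+1 T _) addnS -addSn Tiy.
by apply: (EZ); apply: subspace_sum => // i; apply: EZ.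
Qed.

End Invariance.
End Subspaces.

(** * Star-paranormal operators *)

(* The characteristic roots are [1] and [-2]; positivity excludes the second. *)
Lemma recurrence_constant (R : realType) (v : nat ->
  R) : (forall n, 0 <= v n) ->
  (forall n, v n.+2 + v n.+1 = 2 * v n) -> v 1%N = v 0%N.
Proof.
(* [v n.+1 + 2 * v n] keeps the value [K], while [v n.+1 - v n] is multiplied by -2 at each step; a
   nonzero [d] would make it outgrow [K]. *)
move=> v0 vr; pose d := v 1%N - v 0%N; pose K := v 1%N + 2 * v 0%N.
have vK n : v n.+1 + 2 * v n = K by elim: n => // n <-; have := vr n; lra.
have vd n : v n.+1 - v n = (- 2) ^+ n * d.
  elim: n => [|n IH]; first by rewrite expr0 mul1r.
  by rewrite exprS -mulrA -IH; have := vr n; lra.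
apply/eqP; rewrite -subr_eq0 -/d; apply/negPn/negP => d0.
have dK n : 2 ^+ n * `|d| <= K.
  have -> : 2 ^+ n * `|d| = `|v n.+1 - v n|.
    by rewrite vd normrM normrX normrN normr_nat.
  rewrite ler_norml; have := vK n; have := v0 n; have := v0 n.+1; lra.
have d0' : 0 < `|d| by rewrite normr_gt0.
have K0 : 0 <= K by rewrite /K addr_ge0 ?mulr_ge0.
have /archi_boundP : 0 <= K / `|d| by rewrite divr_ge0.
set n := Num.bound _; rewrite ltr_pdivrMr // => h.
have := le_lt_trans (dK n) h; rewrite ltr_pM2r // -natrX ltr_nat.
by rewrite ltnNge ltnW // ltn_expl.
Qed.

Section StarParanormal.
Context {R : realType} {V : realHilbert R} (T Ts : {linear V -> V}) (C : R).
Hypothesis adj : forall x y, ip (T x) y = ip x (Ts y).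
Hypothesis C0 : 0 <= C.
Hypothesis TC : forall x, sq (T x) <= C * sq x.
Hypothesis para : forall x, sq (Ts x) ^+ 2 <= sq (T (T x)) * sq x.
Implicit Types (x y z v : V) (s t u : R) (M E : V -> Prop).

(** [|T z|^2 = <z, T^*T z> <= |z| |T^*T z|], and *-paranormality at [T z] bounds [|T^*T z|^2] by
    [|T^3 z| |T z|]; a factor [|T z|] cancels. *)
Lemma para_cube z : sq (T z) ^+ 3 <= sq (T (T (T z))) * sq z ^+ 2.
Proof.
have h1 : sq (T z) ^+ 2 <= sq z * sq (Ts (T z)) by rewrite {1}/sq adj CS.
have h2 := para (T z); have q0 := sq_ge0 (T z).
have [q_gt0|] := ltP 0 (sq (T z)); last first.
  move=> qle; have -> : sq (T z) = 0 by apply/eqP; rewrite eq_le qle.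
  by rewrite expr0n mulr_ge0 ?sq_ge0 ?sqr_ge0.
rewrite -(ler_pM2r q_gt0) -exprSr.
have -> : sq (T z) ^+ 4 = (sq (T z) ^+ 2) ^+ 2 by rewrite -exprM.
apply: (@le_trans _ _ ((sq z * sq (Ts (T z))) ^+ 2)).
  by rewrite ler_sqr ?nnegrE ?mulr_ge0 ?sq_ge0 ?sqr_ge0.
by rewrite exprMn [leRHS]mulrAC [leRHS]mulrC ler_wpM2l ?sqr_ge0.
Qed.

(* Hereditary form of [s (X^2 + u X - 2 u^2) = s (X - u) (X + 2 u)]. *)
Definition pform s u x y : R :=
  s * (ip (T (T x)) (T (T y)) + u * ip (T x) (T y) - 2 * u ^+ 2 * ip x y).

Lemma pformE s u x :
  pform s u x x = s * (sq (T (T x)) + u * sq (T x) - 2 * u ^+ 2 * sq x).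
Proof. by []. Qed.

Lemma pform_symform s u : 0 <= u -> symform (pform s u).
Proof.
move=> u0; split.
- move=> x y; rewrite /pform (ipC (T (T x))) (ipC (T x)) (ipC x y) //.
- by move=> x y z; rewrite /pform !linearD !ipDl; ring.
- by move=> a x y; rewrite /pform !(linearZ_LR T) !ipZl; ring.
- exists (`|s| * (C * C + u * C + 2 * u ^+ 2)) => [|x].
    by rewrite mulr_ge0 // !addr_ge0 // mulr_ge0 // sqr_ge0.
  rewrite pformE -[leRHS]mulrA; apply: (le_trans (ler_norm _)).
  rewrite normrM ler_wpM2l //.
  have h1 := TC x; have h2 := TC (T x); have h3 := sq_ge0 x.
  have h4 := sq_ge0 (T x); have h5 := sq_ge0 (T (T x)).
  have h6 : u * sq (T x) <= u * (C * sq x) by rewrite ler_wpM2l.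
  have h7 : C * sq (T x) <= C * (C * sq x) by rewrite ler_wpM2l.
  have h8 : 0 <= u ^+ 2 * sq x by rewrite mulr_ge0 ?sqr_ge0.
  have h9 : 0 <= u * sq (T x) by rewrite mulr_ge0.
  rewrite ler_norml; lra.
Qed.

(* The difference is [X^3 - 3 u^2 X + 2 u^3 = (X - u)^2 (X + 2 u)], nonnegative
   by [para_cube] and AM-GM. *)
Lemma pform_step u x : 0 <= u -> u * pform 1 u x x <= pform 1 u (T x) (T x).
Proof.
move=> u0; rewrite !pformE !mul1r -subr_ge0.
have := para_cube x; have := sq_ge0 (T (T (T x))); have := sq_ge0 x.
have := sq_ge0 (T x).
move: (sq (T (T (T x)))) (sq (T (T x))) (sq (T x)) (sq x) => a p q r q0 r0 a0 h.
have -> : a + u * p - 2 * u ^+ 2 * q - u * (p + u * q - 2 * u ^+ 2 * r)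
  = a + 2 * (u ^+ 3 * r) - 3 * (u ^+ 2 * q) by ring.
have hb : (u ^+ 2 * q) ^+ 3 <= a * (u ^+ 3 * r) ^+ 2.
  have -> : (u ^+ 2 * q) ^+ 3 = u ^+ 6 * q ^+ 3 by ring.
  have -> : a * (u ^+ 3 * r) ^+ 2 = u ^+ 6 * (a * r ^+ 2) by ring.
  by rewrite ler_wpM2l // exprn_ge0.
have b0 : 0 <= u ^+ 3 * r by rewrite mulr_ge0 ?exprn_ge0.
have w0 : 0 <= u ^+ 2 * q by rewrite mulr_ge0 ?exprn_ge0.
move: hb b0 w0; move: (u ^+ 3 * r) (u ^+ 2 * q) => b w hb b0 w0.
rewrite subr_ge0 leNgt; apply/negP => hw.
have h1 : (a + 2 * b) ^+ 3 < (3 * w) ^+ 3.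
  by rewrite ltrXn2r // ?nnegrE; lra.
have h2 : 0 <= (a - b) ^+ 2 * (a + 8 * b).
  by rewrite mulr_ge0 ?sqr_ge0 //; lra.
have : (a + 2 * b) ^+ 3 = (a - b) ^+ 2 * (a + 8 * b) + 27 * (a * b ^+ 2)
  by ring.
have : (3 * w) ^+ 3 = 27 * w ^+ 3 by ring.
lra.
Qed.

(** Along an orbit in [E], the vanishing of the form divided by [s * u ^+ n.+2] is the recurrence of
    [recurrence_constant]. *)
Lemma pform_null_isometry E s u : 0 < u -> s != 0 ->
  (forall x, E x -> E (T x)) -> (forall x, E x -> pform s u x x = 0) ->
  forall x, E x -> sq (T x) = u * sq x.
Proof.
move=> u0 s0 TE Ep x Ex; pose v n := sq (iter n T x) / u ^+ n.
have En n : E (iter n T x) by elim: n => //= n; apply: TE.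
have un0 : u != 0 by rewrite gt_eqF.
suff : v 1%N = v 0%N.
  by rewrite /v /= expr0 expr1 divr1 => <-; field.
apply: recurrence_constant => n; rewrite /v.
- by rewrite divr_ge0 ?sq_ge0 ?exprn_ge0 // ltW.
have /eqP := Ep _ (En n); rewrite pformE mulf_eq0 (negPf s0) /=.
rewrite subr_eq0 => /eqP h.
have -> : sq (T (T (iter n T x))) = 2 * u ^+ 2 * sq (iter n T x)
   - u * sq (T (iter n T x)) by rewrite -h addrK.
by rewrite !exprS; field; rewrite expf_neq0 // un0.
Qed.

Definition reducing_normal E := [/\ forall x, E x -> E (T x),
  forall x, E x -> E (Ts x) & forall x, E x -> T (Ts x) = Ts (T x)].

(** If [T y = x], then [|T^* x - u y|^2 = |T^* x|^2 - 2 u |x|^2 + u^2 |y|^2 <= 0], because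
    *-paranormality gives [|T^* x|^2 <= u |x|^2 = u^2 |y|^2]. So [T^*] is [u] times the inverse of
    [T] on [E]. *)
Lemma isometric_reducing E u : 0 < u -> is_subspace E ->
  (forall x, E x -> E (T x)) -> (forall x, E x -> exists2 y, E y & T y = x) ->
  (forall x, E x -> sq (T x) = u * sq x) -> reducing_normal E.
Proof.
move=> u0 [_ _ EZ] TE Tsurj Tu.
have TsE x y : E x -> E y -> T y = x -> Ts x = u *: y.
  move=> Ex Ey yx; apply/eqP; rewrite -subr_eq0; apply/eqP/sq_eq0.
  rewrite {1}/sq (sf_sub (@ip_symform R V)) -!/(sq _) sqZ.
  rewrite (sfZr (@ip_symform R V)) (ipC (Ts x)) -adj yx -/(sq x).
  have hx : sq x = u * sq y by rewrite -yx Tu.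
  have h := para x; rewrite !Tu ?hx // in h; last exact: TE.
  rewrite hx.
  have u0' := ltW u0.
  have : sq (Ts x) <= u * (u * sq y).
    rewrite -ler_sqr ?nnegrE ?mulr_ge0 ?sq_ge0 //.
    by apply: (le_trans h); rewrite le_eqVlt; apply/orP; left; apply/eqP; ring.
  lra.
split=> // [x Ex|x Ex]; have [y Ey yx] := Tsurj x Ex; rewrite (TsE x y) //.
  exact: EZ.
by rewrite (TsE (T x) x) // ?linearZ /= ?yx //; apply: TE.
Qed.

(** The kernel [E] of the form is finite-dimensional by coercivity. By [pform_step] it contains
    preimages of its vectors if [s = 1] and their images if [s = -1]; finite dimension supplies the
    other half, so [T] maps [E] onto [E]. *)
Lemma pform_kernel_reducing M s u vs z : 0 < u -> s = 1 \/ s = -1 ->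
  is_subspace M -> (forall x, M x -> M (T x)) ->
  (s = 1 -> forall x, M x -> exists2 y, M y & T y = x) ->
  psd (pform s u) M -> coercive (pform s u) (fun x => M x /\ orthto vs x) ->
  M z -> pform s u z z = 0 -> exists2 E, E z & reducing_normal E.
Proof.
move=> u0 hs hM TM Tsurj Bp [c c0 Bc] Mz Bz.
have hB : symform (pform s u) by apply: pform_symform; exact: ltW.
pose E x := M x /\ forall y, M y -> pform s u x y = 0.
have hE : is_subspace E.
  apply: subspaceI => //; apply: subspace_forall => y.
  split=> [_|x x' hx hx' My|a x hx My]; first exact: sf0l.
    by rewrite sfDl // hx // hx' // addr0.
  by rewrite sfZl // hx // mulr0.
have EP x : M x -> pform s u x x = 0 -> E x.
  by move=> Mx Bx; split=> // y My; apply: (psd_ker hB hM Bp).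
have E0 x : E x -> pform s u x x = 0 by case=> Mx; apply.
have Efin x : E x -> orthto vs x -> x = 0.
  move=> Ex hx; apply: sq_eq0; have [Mx _] := Ex.
  by have := Bc x (conj Mx hx); rewrite E0 // pmulr_rle0.
have s0 : s != 0 by case: hs => ->; rewrite ?oppr_eq0 oner_eq0.
have [TE TEs] : (forall x, E x -> E (T x)) /\
    (forall x, E x -> exists2 y, E y & T y = x).
  case: hs => hs.
    have TEs x : E x -> exists2 y, E y & T y = x.
      move=> Ex; have [y My yx] := Tsurj hs x Ex.1; exists y => //.
      apply: EP => //; apply/eqP; rewrite eq_le (Bp y My) andbT.
      have := pform_step y (ltW u0); rewrite yx -hs (E0 x Ex).
      by rewrite pmulr_rle0.
    by split=> //; exact: (fin_invariant hE Efin TEs).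
  have TE x : E x -> E (T x).
    move=> Ex; have [Mx _] := Ex; have MTx := TM _ Mx; apply: EP => //.
    apply/eqP; rewrite eq_le (Bp _ MTx) andbT.
    have := pform_step x (ltW u0); have := E0 x Ex.
    by rewrite hs !pformE; nra.
  split=> //; apply: (fin_surjective hE Efin TE) => x Ex Tx.
  apply: sq_eq0; have := pform_null_isometry u0 s0 TE E0 Ex.
  rewrite Tx sq0 => /esym/eqP; rewrite mulf_eq0 gt_eqF //= => /eqP->;
    exact: lexx.
exists E; first exact: EP.
apply: (isometric_reducing u0 hE TE TEs).
exact: (pform_null_isometry u0 s0 TE E0).
Qed.

Variable g : R.
Hypothesis g0 : 0 <= g.
Hypothesis ess : forall e : R, 0 < e -> exists vs, forall x, orthto vs x ->
  (g - e) * sq x <= sq (T x) /\ sq (T x) <= (g + e) * sq x.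

Lemma orthto_cat vs ws x : orthto (vs ++ ws) x -> orthto vs x /\ orthto ws x.
Proof.
by move=> h; split=> v hv; apply: h; rewrite mem_cat hv ?orbT.
Qed.

Lemma orthto_map vs x : orthto (map Ts vs) x -> orthto vs (T x).
Proof. by move=> h v hv; rewrite adj; apply: h; apply: map_f. Qed.

(** Adding [map Ts vs] to [vs] makes [ess] available at both [x] and [T x]; with [a] strictly
    between [u] and [g] the form is then at least [|a - u| (a + 2 u) |x|^2]. *)
Lemma pform_cofinite M s u : 0 <= u -> s = 1 /\ u < g \/ s = -1 /\ g < u ->
  exists vs, coercive (pform s u) (fun x => M x /\ orthto vs x).
Proof.
have gpos := g0; move=> u0 [] [-> ug].
  have [a ua ag] : exists2 a, u < a & a < g.
    by exists ((u + g) / 2); [case: (midf_lt ug)|case: (midf_lt ug)].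
  have a0 : 0 < a + 2 * u by lra.
  have [|vs hvs] := @ess (g - a); first by rewrite subr_gt0.
  exists (vs ++ map Ts vs), ((a - u) * (a + 2 * u)).
    by rewrite mulr_gt0 // subr_gt0.
  move=> x [_ /orthto_cat[/hvs[+ _] /orthto_map/hvs[+ _]]].
  rewrite subKr pformE mul1r => h1 h2.
  have au : 0 <= a + u by lra.
  have := ler_wpM2l au h1; lra.
have [a ga au] : exists2 a, g < a & a < u.
  by exists ((g + u) / 2); [case: (midf_lt ug)|case: (midf_lt ug)].
have a0 : 0 < a + 2 * u by lra.
have [|vs hvs] := @ess (a - g); first by rewrite subr_gt0.
exists (vs ++ map Ts vs), ((u - a) * (a + 2 * u)).
  by rewrite mulr_gt0 // subr_gt0.
move=> x [_ /orthto_cat[/hvs[_ +] /orthto_map/hvs[_ +]]].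
rewrite [g + _]addrC subrK pformE mulN1r => h1 h2.
have au0 : 0 <= a + u by lra.
have := ler_wpM2l au0 h1; lra.
Qed.

(** * A reducing subspace without normal part *)

Section Pure.
Variable M : V -> Prop.
Hypotheses (hM : is_subspace M) (Mcl : sqclosed M).
Hypothesis TM : forall x, M x -> M (T x).
Hypothesis TsM : forall x, M x -> M (Ts x).
Hypothesis Mpure : forall E z, reducing_normal E -> E z -> M z -> z = 0.

(** By *-paranormality [T^2 y = 0] forces [T^* y = 0]; for [y = T z] this gives
    [|T z|^2 = <z, T^*T z> = 0]. *)
Lemma ker_sqr z : T (T z) = 0 -> T z = 0 /\ Ts z = 0.
Proof.
have Ts0 y : T (T y) = 0 -> Ts y = 0.
  move=> TTy; apply: sq_eq0; have := para y; rewrite TTy sq0 mul0r.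
  move=> h; have : sq (Ts y) ^+ 2 == 0 by rewrite eq_le h sqr_ge0.
  by rewrite sqrf_eq0 => /eqP ->.
move=> TTz; split; last exact: Ts0.
by apply: sq_eq0; rewrite /sq adj Ts0 ?(sf0r (@ip_symform R V)) // TTz linear0.
Qed.

Lemma pure_injective z : M z -> T (T z) = 0 -> z = 0.
Proof.
move=> Mz /ker_sqr[Tz Tsz].
apply: (@Mpure (fun x => T x = 0 /\ Ts x = 0)) => //.
by split=> x [Tx Tsx]; rewrite ?Tx ?Tsx ?linear0.
Qed.

(** Continuation downwards from [U >= C], where [|T x|^2 <= C |x|^2] makes the form negative
    semidefinite; a kernel met on the way contradicts [Mpure]. *)
Lemma pure_upper u x : g < u -> M x ->
  sq (T (T x)) + u * sq (T x) <= 2 * u ^+ 2 * sq x.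
Proof.
have gpos := g0; have Cpos := C0; move=> gu Mx; pose U := Num.max C u.
have uU : u <= U by rewrite le_max lexx orbT.
have CU : C <= U by rewrite le_max lexx.
have tu t : - U <= t <= - u -> [/\ 0 <= - t, g < - t & - t <= U].
  by move=> /andP[h1 h2]; split; lra.
(* [continuation] moves its parameter upwards, hence the sign change; [C + 4 * U] is a Lipschitz
   constant in the parameter. *)
have := @continuation R V (fun t => pform (-1) (- t)) M (- U) (- u) (C + 4 * U).
case.
- by rewrite lerN2.
- by apply: addr_ge0 => //; apply: mulr_ge0 => //; lra.
- exact: hM.
- exact: Mcl.
- by move=> t /tu[t0 _ _]; apply: pform_symform.
- by move=> t /tu[t0 gt _]; apply: pform_cofinite => //; right.
- move=> s t y /tu[s0 _ sU] /tu[t0 _ tU].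
  rewrite !pformE; have h1 := TC y; have q0 := sq_ge0 (T y);
    have r0 := sq_ge0 y.
  have := normr_ge0 (s - t); have := ler_norm (s - t);
    have := lerNnormlW (lexx `|s - t|).
  move: `|s - t| => n hn1 hn2 n0.
  have h2 : (s - t) * sq (T y) <= n * (C * sq y)
    by apply: le_trans (ler_wpM2l n0 h1); apply: ler_wpM2r.
  have h3 : (s - t) * (- (s + t)) <= n * (2 * U).
    apply: (@le_trans _ _ (n * (- (s + t)))); first by apply: ler_wpM2r => //;
      lra.
    by apply: ler_wpM2l => //; lra.
  have h4 : - n <= s - t by lra.
  have h5 : (t - s) * (- (s + t)) <= n * (2 * U).
    apply: (@le_trans _ _ (n * (- (s + t)))); first by apply: ler_wpM2r; lra.
    by apply: ler_wpM2l => //; lra.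
  have h6 : (t - s) * sq (T y) <= n * (C * sq y).
    by apply: le_trans (ler_wpM2l n0 h1); apply: ler_wpM2r; lra.
  have h7 := ler_wpM2r r0 h3; have h8 := ler_wpM2r r0 h5; lra.
- move=> y My; rewrite opprK pformE.
  have h1 := TC y; have h2 := TC (T y); have h3 := sq_ge0 y;
    have h4 := sq_ge0 (T y).
  have U0 : 0 <= U by lra.
  have h5 := ler_wpM2r h3 CU; have h6 := ler_wpM2r h4 CU.
  have h7 : U * sq (T y) <= U * (U * sq y) by apply: ler_wpM2l => //; lra.
  lra.
- move=> [t /tu[t0 gt _] [Bp [z [Mz z0 Bz]]]].
  have [vs hvs] := @pform_cofinite M (-1) (- t) t0 (or_intror (conj erefl gt)).
  have [|E Ez hE] := pform_kernel_reducing (le_lt_trans g0 gt) (or_intror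
    erefl) hM TM _ Bp hvs Mz Bz.
    by move=> h; exfalso; move: h; lra.
  by rewrite (Mpure hE Ez Mz) eqxx in z0.
- by move=> /(_ _ Mx); rewrite opprK pformE; lra.
Qed.

Hypothesis Tsurj : 0 < g -> forall x, M x -> exists2 y, M y & T y = x.

Lemma pure_lower u x : 0 < u -> u < g -> M x ->
  2 * u ^+ 2 * sq x <= sq (T (T x)) + u * sq (T x).
Proof.
have Cpos := C0; move=> u0 ug Mx; have gt0 : 0 < g by lra.
have tu t : 0 <= t <= u -> [/\ 0 <= t, t < g & t <= u].
  by move=> /andP[h1 h2]; split; lra.
have := @continuation R V (fun t => pform 1 t) M 0 u (C + 4 * u).
case.
- by apply: ltW.
- by apply: addr_ge0 => //; apply: mulr_ge0 => //; lra.
- exact: hM.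
- exact: Mcl.
- by move=> t /tu[t0 _ _]; apply: pform_symform.
- by move=> t /tu[t0 gt _]; apply: pform_cofinite => //; left.
- move=> s t y /tu[s0 _ sU] /tu[t0 _ tU].
  rewrite !pformE; have h1 := TC y; have q0 := sq_ge0 (T y);
    have r0 := sq_ge0 y.
  have := normr_ge0 (s - t); have := ler_norm (s - t);
    have := lerNnormlW (lexx `|s - t|).
  move: `|s - t| => n hn1 hn2 n0.
  have h5 : (s - t) * (s + t) <= n * (2 * u).
    apply: (@le_trans _ _ (n * (s + t))); first by apply: ler_wpM2r; lra.
    by apply: ler_wpM2l => //; lra.
  have h6 : (t - s) * sq (T y) <= n * (C * sq y).
    by apply: le_trans (ler_wpM2l n0 h1); apply: ler_wpM2r; lra.
  have h8 := ler_wpM2r r0 h5.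
  have h9 : 0 <= n * (2 * u) * sq y by rewrite !mulr_ge0 //; lra.
  lra.
- by move=> y My; rewrite pformE expr0n /= !(mulr0,
  mul0r) addr0 subr0 mul1r sq_ge0.
- move=> [t /tu[t0 gt _] [Bp [z [Mz z0 Bz]]]].
  have [vs hvs] := @pform_cofinite M 1 t t0 (or_introl (conj erefl gt)).
  have [tpos|tle] := ltP 0 t.
    have [|E Ez hE] := pform_kernel_reducing tpos (or_introl erefl) hM TM _ Bp
      hvs Mz Bz.
      by move=> _; exact: Tsurj.
    by rewrite (Mpure hE Ez Mz) eqxx in z0.
  (* [pform_kernel_reducing] requires a positive parameter; at 0 the form is [|T^2 z|^2], whose
     kernel in [M] is trivial by [pure_injective]. *)
  have te : t = 0 by apply/eqP; rewrite eq_le tle.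
  move: Bz; rewrite te pformE expr0n /= !(mulr0, mul0r) addr0 subr0 mul1r => Tz.
  by move: z0; rewrite (pure_injective Mz) ?eqxx //; apply: sq_eq0; rewrite Tz.
- by move=> /(_ _ Mx); rewrite pformE; lra.
Qed.

(** Both semidefinite bounds pass to the limit as [u] tends to [g]; for [g = 0] the lower one is
    plain nonnegativity. *)
Lemma pure_null x : M x ->
  sq (T (T x)) + g * sq (T x) = 2 * g ^+ 2 * sq x.
Proof.
have gpos := g0; move=> Mx; have r0 := sq_ge0 x; have q0 := sq_ge0 (T x).
apply/eqP; rewrite eq_le; apply/andP; split; apply/ler_addgt0Pr => e e0.
  have k0 : 0 < 2 * (2 * g + 1) * sq x + 1.
    by apply: ltr_wpDl => //; apply: mulr_ge0 => //; lra.
  have [d [d0 d1 dk]] : exists d, [/\ 0 < d, d <= 1 &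
      d * (2 * (2 * g + 1) * sq x + 1) <= e].
    exists (Num.min 1 (e / (2 * (2 * g + 1) * sq x + 1))).
    split; first by rewrite lt_min ltr01 divr_gt0.
      by rewrite ge_min lexx.
    by rewrite -ler_pdivlMr // ge_min lexx orbT.
  have := @pure_upper (g + d) x; rewrite ltrDl => /(_ d0 Mx).
  have -> : 2 * (g + d) ^+ 2 * sq x = 2 * g ^+ 2 * sq x
    + d * (2 * (2 * g + d) * sq x) by ring.
  have dq : 0 <= d * sq (T x) by rewrite mulr_ge0 // ltW.
  have : d * (2 * (2 * g + d) * sq x) <= d * (2 * (2 * g + 1) * sq x).
    rewrite ler_wpM2l ?(ltW d0) // ler_wpM2r //; lra.
  lra.
have [gt0|gle] := ltP 0 g; last first.
  have -> : g = 0 by apply/eqP; rewrite eq_le gle g0.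
  rewrite expr0n /= !(mulr0, mul0r) addr0 addr_ge0 ?sq_ge0 //; exact: ltW.
have k0 : 0 < 4 * g * sq x + 1.
  by apply: ltr_wpDl => //; apply: mulr_ge0 => //; lra.
have [d [d0 dg dk]] : exists d, [/\ 0 < d, d < g & d * (4 * g * sq x + 1) <= e].
  exists (Num.min (g / 2) (e / (4 * g * sq x + 1))).
  split; first by rewrite lt_min !divr_gt0.
    by rewrite gt_min; apply/orP; left; lra.
  by rewrite -ler_pdivlMr // ge_min lexx orbT.
have := @pure_lower (g - d) x; rewrite subr_gt0 gtrBl => /(_ dg d0 Mx).
have -> : 2 * (g - d) ^+ 2 * sq x = 2 * g ^+ 2 * sq x
  - d * (4 * g * sq x) + 2 * d ^+ 2 * sq x by ring.
have dq : 0 <= d * sq (T x) by rewrite mulr_ge0 // ltW.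
have : 0 <= 2 * d ^+ 2 * sq x by apply: mulr_ge0 => //; apply: mulr_ge0 => //;
  exact: sqr_ge0.
lra.
Qed.

(** [M] itself is a set excluded by [Mpure]: by [pure_null], [T] is on [M] a multiple of an isometry
    if [g > 0], and [T^2 = 0] there if [g = 0]. *)
Lemma pure_trivial x : M x -> x = 0.
Proof.
move=> Mx; apply: (@Mpure M) Mx (Mx).
have [gt0|gle] := ltP 0 g.
  apply: (isometric_reducing gt0 hM TM (Tsurj gt0)).
  apply: (@pform_null_isometry M 1 g gt0 (oner_neq0 R) TM) => y My.
  by rewrite pformE mul1r pure_null // subrr.
have ge : g = 0 by apply/eqP; rewrite eq_le gle g0.
split=> // y My; have := pure_null My.
rewrite ge expr0n /= !(mulr0, mul0r) addr0 => /eqP h.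
have /ker_sqr[-> ->] : T (T y) = 0 by apply: sq_eq0; rewrite (eqP h).
by rewrite !linear0.
Qed.

End Pure.

Hypothesis kerTs : 0 < g -> forall x, Ts x = 0 -> T x = 0.

Theorem star_paranormal_normal x : T (Ts x) = Ts (T x).
Proof.
pose M x := forall y, (exists2 E, reducing_normal E & E y) -> ip x y = 0.
have hM : is_subspace M.
  apply: subspace_forall => y; have [y0 yD yZ] := subspace_orth y.
  split=> [_|w v hw hv hy|a w hw hy]; [exact: y0|apply: yD; auto|apply: yZ;
    auto].
have Mcl : sqclosed M.
  apply: sqclosed_forall => y u hu hy; apply: (@sqclosed_orth _ _ y).
  by move=> e /hu[v vy uv]; exists v; auto.
have adjs (u v : V) : ip (Ts u) v = ip u (T v) by rewrite ipC -adj ipC.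
have TM (u : V) : M u -> M (T u).
  by move=> Mu y [E hE Ey]; rewrite adj; apply: Mu; exists E => //; case: hE;
    auto.
have TsM (u : V) : M u -> M (Ts u).
  by move=> Mu y [E hE Ey]; rewrite adjs; apply: Mu; exists E => //; case: hE;
    auto.
have Mpure E z : reducing_normal E -> E z -> M z -> z = 0.
  by move=> hE Ez Mz; apply: sq_eq0; rewrite /sq (Mz z) //; exists E.
(* Least squares: [T] is bounded below on [M], so some [p] in [M] solves [<T p, T y> = <v, T y>].
   The residual [w = T p - v] has [T^* w = 0], so [T w = 0] by [kerTs], and [w = 0]. *)
have Tsurj : 0 < g -> forall v, M v -> exists2 y, M y & T y = v.
  move=> gt0 v Mv; pose P x y := ip (T x) (T y).
  have hP : symform P.
    split; rewrite /P; [by move=> *; exact: ipC| | |by exists C].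
    - by move=> *; rewrite linearD ipDl.
    - by move=> *; rewrite (linearZ_LR T) ipZl.
  have Pp : psd P M by move=> w _; exact: sq_ge0.
  have g2 : 0 < g / 2 by rewrite divr_gt0.
  have [vs hvs] := ess g2.
  have Pvs : coercive P (fun w => M w /\ orthto vs w).
    exists (g / 2) => // w [_ /hvs[h _]]; rewrite /P -/(sq _).
    by apply: le_trans h; rewrite {2}[g]splitr addrK.
  have [[z [Mz z0 Pz]]|Pco] := kernel_or_coercive hP hM Mcl Pp Pvs.
    move: z0; rewrite (pure_injective Mpure Mz) ?eqxx //.
    by rewrite (_ : T z = 0) ?linear0 //; apply: sq_eq0;
      rewrite /sq -/(P z z) Pz.
  have [||||p Mp hp] :=
    @riesz_coercive _ _ P M (fun y => ip v (T y)) (sq v * C) _ hP hM Mcl Pco.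
  - by rewrite mulr_ge0 ?sq_ge0.
  - by move=> y z; rewrite linearD (sfDr (@ip_symform R V)).
  - by move=> a y; rewrite (linearZ_LR T) (sfZr (@ip_symform R V)).
  - move=> y _; apply: (le_trans (CS _ _)).
    by rewrite -mulrA ler_wpM2l ?sq_ge0.
  exists p => //; apply/eqP; rewrite -subr_eq0; apply/eqP.
  set w := T p - v; have Mw : M w by exact: (subspaceB hM (TM _ Mp) Mv).
  apply: (pure_injective Mpure Mw); rewrite (kerTs gt0 (x := w)) ?linear0 //.
  apply: sq_eq0; rewrite /sq adjs /w ipDl (sfNl (@ip_symform R V)).
  by rewrite -/(P _ _) hp ?subrr //; exact: TsM.
have Mtriv := pure_trivial hM Mcl TM TsM Mpure Tsurj.
(* The commutator of [T] and [T^*] is self-adjoint and vanishes on every normal reducing set, so its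
   values lie in [M]. *)
apply/eqP; rewrite -subr_eq0; apply/eqP/Mtriv => y [E hE Ey].
rewrite ipDl (sfNl (@ip_symform R V)) adj adjs adjs adj.
by case: hE => _ _ ->; rewrite ?subrr.
Qed.

End StarParanormal.

(** * Restriction of scalars *)

Section InnerProduct.
Context {R : realType} {H : hilbertType R}.
Implicit Types (x y z : H) (a : R[i]) (t : R).
Local Open Scope complex_scope.

Definition reip x y : R := complex.Re (inner x y).

Definition nr x : R := complex.Re `|x|.

Lemma normE x : `|x| = (nr x)%:C.
Proof. by rewrite /nr RRe_real // normr_real. Qed.

Lemma nr_ge0 x : 0 <= nr x.
Proof. by rewrite -lecR -normE normr_ge0. Qed.

Lemma nr_triangle x y : nr (x + y) <= nr x + nr y.
Proof. by rewrite -lecR rmorphD /= -!normE ler_normD. Qed.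

Lemma inner_conj x y : inner x y = (inner y x)^*.
Proof. by rewrite hermC /= expr0 mul1r. Qed.

Lemma innerDl x y z : inner (x + y) z = inner x z + inner y z.
Proof. by rewrite linearDl. Qed.

Lemma innerZl a x y : inner (a *: x) y = a * inner x y.
Proof. by rewrite linearZl_LR. Qed.

Lemma reipC x y : reip x y = reip y x.
Proof. by rewrite /reip inner_conj; case: (inner y x). Qed.

Lemma reipDl x y z : reip (x + y) z = reip x z + reip y z.
Proof. by rewrite /reip innerDl raddfD. Qed.

Lemma reipZl t x y : reip (t%:C *: x) y = t * reip x y.
Proof. by rewrite /reip innerZl; case: (inner x y) => u v /=;
  rewrite mul0r subr0. Qed.

Lemma reipE x : reip x x = nr x ^+ 2.
Proof.
by rewrite /reip -sqr_norm_inner normE -rmorphXn.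
Qed.

Lemma nr_eq0 x : nr x = 0 -> x = 0.
Proof. by move=> h; apply/normr0_eq0; rewrite normE h. Qed.

Lemma reip_i x y : reip x ('i *: y) = complex.Im (inner x y).
Proof.
rewrite reipC /reip innerZl inner_conj; case: (inner x y) => u v /=.
by rewrite mul0r mul1r sub0r opprK.
Qed.

Lemma inner_eq0 x y : reip x y = 0 -> reip x ('i *: y) = 0 -> inner x y = 0.
Proof.
by rewrite reip_i /reip; case: (inner x y) => u v /= -> ->.
Qed.

(** A separate name for the carrier keeps the real scalar action apart from the complex one. *)
Definition realified (K : hilbertType R) : Type := K.
HB.instance Definition _ := GRing.Zmodule.copy (realified H) H.

Definition rscale t (x : realified H) : realified H := t%:C *: (x : H).

Lemma rscaleA s t (x : realified H) : rscale s (rscale t x) = rscale (s * t) x.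
Proof. by rewrite /rscale scalerA -rmorphM. Qed.

Lemma rscale1 : left_id 1 rscale.
Proof. by move=> x; rewrite /rscale scale1r. Qed.

Lemma rscaleDr : right_distributive rscale +%R.
Proof. by move=> t x y; rewrite /rscale scalerDr. Qed.

Lemma rscaleDl (x : realified H) : {morph rscale^~ x : s t / s + t}.
Proof. by move=> s t; rewrite /rscale rmorphD scalerDl. Qed.

HB.instance Definition _ := GRing.Zmodule_isLmodule.Build R (realified H)
  rscaleA rscale1 rscaleDr rscaleDl.

Lemma reip_gt0 x : x != 0 -> 0 < reip x x.
Proof.
move=> x0; rewrite reipE exprn_gt0 // lt_def nr_ge0 andbT.
by apply: contraNneq x0 => /nr_eq0 ->.
Qed.

Lemma reip_complete (u : nat -> H) :
    (forall e : R, 0 < e -> exists N, forall m n, (N <= m)%N -> (N <= n)%N ->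
      reip (u m - u n) (u m - u n) < e) ->
    exists l : H, forall e : R, 0 < e -> exists N, forall n, (N <= n)%N ->
      reip (u n - l) (u n - l) < e.
Proof.
move=> hu.
have : cvg (u @ \oo)%classic.
  apply/cauchy_cvgP/cauchy_exP => e e0.
  have [r eE] : exists r : R, e = r%:C by apply/complex_realP; exact: gtr0_real.
  have r0 : 0 < r by rewrite -ltcR -eE.
  have [|N hN] := hu (r ^+ 2); first by rewrite exprn_gt0.
  exists (u N); exists N => // n /= Nn.
  rewrite -ball_normE /=
    normE eE ltcR -(ltr_pXn2r (isT : (0 < 2)%N)) ?nnegrE ?nr_ge0 ?(ltW r0) //.
  by rewrite -reipE; apply: hN.
move=> /cvgrPdist_lt hl; exists (lim (u @ \oo)%classic) => e e0.
have := hl (Num.sqrt e)%:C; rewrite ltcR sqrtr_gt0 => /(_ e0)[N _ hN].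
exists N => n /hN /=; rewrite normE ltcR reipE /nr -normrN opprB -/(nr _) => h.
rewrite -[e]sqr_sqrtr ?(ltW e0) // (ltr_pXn2r (isT : (0 < 2)%N)) //.
  by rewrite nnegrE nr_ge0.
by rewrite nnegrE sqrtr_ge0.
Qed.

Definition realH : realHilbert R :=
  @RealHilbert R (realified H) reip reipC reipDl reipZl reip_gt0 reip_complete.

End InnerProduct.

(** * Absolutely norm attaining operators and their closure *)

(** Each term is chosen against the concatenated lists [F (z i)] of all earlier terms; [Q] stands
    for orthogonality to a list. *)
Lemma greedy_sequence (I : eqType) (P : nat -> I -> Prop) (F : I -> seq I)
    (Q : seq I -> I -> Prop) :
  (forall s t x, Q (s ++ t) x -> Q s x /\ Q t x) ->
  (forall n s, exists x, P n x /\ Q s x) ->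
  exists z : nat -> I, (forall n, P n (z n)) /\
    forall i n, (i < n)%N -> Q (F (z i)) (z n).
Proof.
move=> Qcat h.
have /choice[c cP] : forall ns : nat * seq I, exists x, P ns.1 x /\ Q ns.2 x.
  by move=> ns; exact: h.
pose l := fix l n := if n is m.+1 then F (c (m, l m)) ++ l m else [::].
exists (fun n => c (n, l n)); split=> [n|i n]; first by case: (cP (n, l n)).
have lQ m : (i < m)%N -> forall x, Q (l m) x -> Q (F (c (i, l i))) x.
  elim: m => // m IH; rewrite ltnS leq_eqVlt => /orP[/eqP <-|im] x /=
    /Qcat[] //.
  by move=> _; apply: IH.
by move=> /lQ; apply; case: (cP (n, l n)).
Qed.

Section Interpolation.
Context {R : realType} {V : realHilbert R} (T Ts : {linear V -> V}).
Hypothesis adj : forall x y, ip (T x) y = ip x (Ts y).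

(** The high vector [y] is taken orthogonal to the low vector [x] and to [T^*T x], so that
    [|x + t y|^2] and [|T (x + t y)|^2] have no cross terms and [t ^+ 2] solves a linear
    equation. *)
Lemma gap_interpolate (a b s : R) : a < s -> s < b ->
  (forall vs, exists x, orthto vs x /\ sq (T x) < a * sq x) ->
  (forall vs, exists x, orthto vs x /\ b * sq x < sq (T x)) ->
  forall vs, exists x, [/\ orthto vs x, x != 0 & sq (T x) = s * sq x].
Proof.
move=> as_ sb lo hi vs; have [x [xvs xlo]] := lo vs.
have [y [/orthto_cat[yvs yx] yhi]] := hi (vs ++ [:: x; Ts (T x)]).
have xy : ip x y = 0 by rewrite ipC yx // inE eqxx.
have Txy : ip (T x) (T y) = 0 by rewrite ipC adj yx // !inE eqxx orbT.
have x0 := sq_ge0 x; have y0 := sq_ge0 y.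
have p0 : 0 < s * sq x - sq (T x) by nra.
have q0 : 0 < sq (T y) - s * sq y by nra.
pose t := Num.sqrt ((s * sq x - sq (T x)) / (sq (T y) - s * sq y)).
have t2 : t ^+ 2 = (s * sq x - sq (T x)) / (sq (T y) - s * sq y).
  by rewrite sqr_sqrtr // divr_ge0 // ltW.
exists (x + t *: y); split.
- have h := @subspace_orth R V.
  by move=> v vvs; case: (h v) => _ hD hZ; apply: hD; [exact: xvs|apply: hZ;
    exact: yvs].
- apply: contraTneq xlo => xty; rewrite -leNgt.
  have : sq (x + t *: y) = 0 by rewrite xty sq0.
  rewrite /sq (sf_addZ (@ip_symform R V)) xy -!/(sq _) => h.
  have ty0 : 0 <= t ^+ 2 * sq y by rewrite mulr_ge0 ?sqr_ge0.
  have -> : sq x = 0 by lra.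
  by rewrite mulr0 sq_ge0.
- rewrite linearD (linearZ_LR T) /sq !(sf_addZ (@ip_symform R V)) xy Txy
  -!/(sq _).
  rewrite t2; field; by rewrite gt_eqF.
Qed.

End Interpolation.

(** * Bounded operators: adjoints, norms and norm attainment *)

Section BoundedOperators.
Context {R : realType} {H : hilbertType R}.
Implicit Types (x y z : H) (T S : {linear H -> H}) (L A : set H).
Local Open Scope complex_scope.
Local Open Scope classical_set_scope.

Lemma bounded_nr T : bounded_operator T ->
  exists2 C : R, 0 <= C & forall x, nr (T x) <= C * nr x.
Proof.
move=> /linear_boundedP/pinfty_ex_gt0[M M0 hM].
have [r rE] : exists r : R, M = r%:C by apply/complex_realP; exact: gtr0_real.
exists r; first by rewrite -lecR -rE ltW.
by move=> x; rewrite -lecR rmorphM /= -!normE -rE.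
Qed.

Lemma nr_sq x : nr x ^+ 2 = sq (x : realH). Proof. by rewrite /sq /= reipE. Qed.

Lemma le_sq x (y : H) (c : R) : 0 <= c ->
  nr x <= c * nr y -> sq (x : realH) <= c ^+ 2 * sq (y : realH).
Proof.
move=> c0 h; rewrite -!nr_sq -exprMn ler_sqr // nnegrE ?mulr_ge0 ?nr_ge0 //.
Qed.

Lemma bounded_sq T : bounded_operator T ->
  exists2 C : R, 0 <= C & forall x, sq (T x : realH) <= C * sq (x : realH).
Proof.
move=> /bounded_nr[C C0 hC]; exists (C ^+ 2); first exact: sqr_ge0.
by move=> x; apply: le_sq.
Qed.

Section RealLinear.
Variable f : H -> H.
Hypothesis fD : forall x y, f (x + y) = f x + f y.
Hypothesis fZ : forall (a : R[i]) x, f (a *: x) = a *: f x.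

Let g : @realH R H -> @realH R H := f.

Lemma realified_linear : linear g.
Proof. by move=> t x y; rewrite /g fD fZ. Qed.

Definition real_linear : {linear @realH R H -> @realH R H} :=
  HB.pack_for {linear @realH R H -> @realH R H} g
    (GRing.isLinear.Build R (@realH R H) (@realH R H) *:%R g realified_linear).

Lemma real_linearE x : real_linear x = f x. Proof. by []. Qed.

End RealLinear.

Definition rlin T := real_linear (linearD T) (linearZ_LR T).

(** Riesz representation of the real functional [Re <T x, y>] matches the real parts; testing with
    ['i *: u] matches the imaginary ones. *)
Lemma adjointP T x y : bounded_operator T ->
  inner (T x) y = inner x (adjoint T y).
Proof.
move=> /bounded_sq[C C0 TC].
suff [z hz] : exists z, forall x, inner (T x) y = inner x z.
  have := @xgetPex _ 0 [set z | forall x, inner (T x) y = inner x z].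
  by move=> /(_ (ex_intro _ z hz)); apply.
have [||||||||z _ hz] :=
  @riesz_coercive R (@realH R H) (@reip R H) (fun _ => True)
  (fun x => reip (T x) y) (C * sq (y : realH)).
- by rewrite mulr_ge0 // sq_ge0.
- exact: (@ip_symform R (@realH R H)).
- exact: subspaceT.
- by [].
- by exists 1 => // u _; rewrite mul1r.
- by move=> u v; rewrite linearD reipDl.
- by move=> t u; rewrite linearZ_LR reipZl.
- move=> u _; apply: (le_trans (@CS R realH _ _)).
  by rewrite mulrAC ler_wpM2r ?sq_ge0.
exists z => u; have h v : reip (T v) y = reip v z
  by rewrite reipC [RHS]reipC hz // reipC.
have := h ('i *: u); rewrite linearZ_LR /reip !innerZl.
have := h u; rewrite /reip.
case: (inner (T u) y) (inner u z) => [a b] [c d] /= ->.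
by rewrite !mul0r !mul1r !sub0r => /oppr_inj ->.
Qed.

Lemma inner_nondeg x y : (forall z, inner z x = inner z y) -> x = y.
Proof.
move=> h; apply/eqP; rewrite -subr_eq0; apply/eqP.
apply: (@sq_eq0 R realH); rewrite /sq /= /reip.
rewrite inner_conj innerDl -scaleN1r innerZl.
rewrite [inner x _]inner_conj [inner y _]inner_conj h.
by case: (inner _ y) => a b /=; rewrite oppr0; lra.
Qed.

Lemma innerDr x y z : inner x (y + z) = inner x y + inner x z.
Proof. by rewrite linearDr. Qed.

Lemma innerZr a x y : inner x (a *: y) = a^* * inner x y.
Proof. by rewrite linearZr_LR. Qed.

Lemma innerZr_real (t : R) x y : inner x (t%:C *: y) = t%:C * inner x y.
Proof. by rewrite innerZr; congr (_ * _); exact: conjc_real. Qed.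

Lemma innerBr x y z : inner x (y - z) = inner x y - inner x z.
Proof. by rewrite linearBr. Qed.

Lemma adjointD T x y : bounded_operator T ->
  adjoint T (x + y) = adjoint T x + adjoint T y.
Proof.
by move=> bT; apply: inner_nondeg => z;
  rewrite -adjointP // !innerDr -!adjointP.
Qed.

Lemma adjointZ T a x : bounded_operator T ->
  adjoint T (a *: x) = a *: adjoint T x.
Proof.
by move=> bT; apply: inner_nondeg => z;
  rewrite -adjointP // !innerZr -!adjointP.
Qed.

Definition radj T (bT : bounded_operator T) : {linear @realH R H ->
  @realH R H} :=
  real_linear (fun x y => adjointD x y bT) (fun a x => adjointZ a x bT).

Lemma radjP T (bT : bounded_operator T) (x y : @realH R H) :
  ip (rlin T x) y = ip x (radj bT y).
Proof. by rewrite /= /reip adjointP. Qed.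

Lemma closure_sq L x : closure L x -> forall e : R, 0 < e ->
  exists2 y, L y & sq (x - y : realH) < e.
Proof.
move=> Lx e e0; have [|y [Ly]] := Lx (ball x (Num.sqrt e)%:C).
  by apply: nbhsx_ballx; rewrite ltcR sqrtr_gt0.
rewrite -ball_normE /= normE ltcR => h; exists y => //.
rewrite reipE -[e]sqr_sqrtr ?(ltW e0) // (ltr_pXn2r (isT : (0 < 2)%N)) //.
  by rewrite nnegrE nr_ge0.
by rewrite nnegrE sqrtr_ge0.
Qed.

Definition ortho A : set H := [set x | forall y, A y -> inner x y = 0].

Lemma ortho_subspace A : subspace_set (ortho A).
Proof.
split=> [y _|a x z hx hz y Ay]; first by rewrite linear0l.
by rewrite innerDl innerZl hx // hz // mulr0 addr0.
Qed.

Lemma ortho_closed A : closed (ortho A).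
Proof.
move=> x hx y Ay.
have rxy v : (forall u, ortho A u -> reip u v = 0) -> reip x v = 0.
  move=> hv; apply: (@sqclosed_orth R realH v x) => e /(closure_sq hx)[u Au xu].
  by exists u => //; exact: hv.
apply: inner_eq0; apply: rxy => u /(_ _ Ay) h; first by rewrite /reip h.
by rewrite reip_i h.
Qed.

Lemma opnorm_onP T L y : bounded_operator T -> subspace_set L -> L y ->
  nr (T y) <= opnorm_on T L * nr y.
Proof.
move=> /bounded_nr[C C0 TC] [L0 LZ] Ly.
have [->|y0] := eqVneq y 0.
  by rewrite linear0 /nr normr0 /= mulr0.
have ny0 : 0 < nr y.
  by rewrite lt_def nr_ge0 andbT; apply: contraNneq y0 => /nr_eq0 ->.
pose u := (nr y)^-1%:C *: y.
have nru : nr u = 1.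
  rewrite /nr /u normrZ normE normc_def /= expr0n addr0 sqrtr_sqr.
  by rewrite mul0r subr0 ger0_norm ?invr_ge0 ?(ltW ny0) // mulVf // gt_eqF.
have Lu : L u by rewrite -[u]addr0; apply: LZ.
have hs : has_sup [set complex.Re `|T x| | x in L `&` [set x | `|x| <= 1]].
  split; first by exists (complex.Re `|T 0|), 0 => //; split => //=;
    rewrite normr0.
  exists C => _ [x [Lx /= x1] <-]; apply: (le_trans (TC x)).
  by rewrite ler_piMr // -lecR -normE.
have : nr (T u) <= opnorm_on T L.
  apply: ub_le_sup; first by case: hs.
  by exists u => //; split=> //=; rewrite normE nru.
rewrite /u linearZ_LR /nr normrZ (normE (T y)) normc_def /=
  expr0n addr0 sqrtr_sqr.
rewrite mul0r subr0 ger0_norm ?invr_ge0 ?(ltW ny0) //.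
by rewrite mulrC ler_pdivrMr.
Qed.

(* On the closed span of suitable vectors between a low and a high direction
   the operator acts diagonally with strictly increasing norms, so its norm
   there is not attained. *)
Lemma AN_no_gap S (a b : R) : absolutely_norm_attaining S -> a < b ->
  (forall vs, exists x : realH, orthto vs x /\ sq (rlin S x) < a * sq x) ->
  (forall vs, exists x : realH, orthto vs x /\ b * sq x < sq (rlin S x)) ->
    False.
Proof.
move=> [bS AN] ab lo hi.
have [r [r0 rlt]] := @null_sequence R.
(* The index [n.+2] instead of [n.+1] keeps [s 0] strictly above [a]. *)
pose s n : R := b - (b - a) / n.+2%:R.
have sS n : s n < s n.+1.
  by rewrite /s ltrD2l ltrN2 ltr_pM2l ?subr_gt0 // ltf_pV2 ?posrE // ltr_nat.
have sb n : s n < b by rewrite /s ltrBlDr ltrDl divr_gt0 // subr_gt0.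
have as_ n : a < s n.
  rewrite /s ltrBrDr -ltrBrDl ltr_pdivrMr // ltr_pMr ?subr_gt0 // ltr1n //.
pose SS (x : H) := adjoint S (S x).
pose P n (x : @realH R H) := x != 0 /\ sq (rlin S x) = s n * sq x.
(* Real orthogonality to these four vectors is complex orthogonality to [x] and to [S^*S x]. *)
pose F (x : @realH R H) : seq (@realH R H) :=
  [:: x; 'i *: (x : H); SS x; 'i *: SS x].
have [||z [zP zF]] :=
  @greedy_sequence (@realH R H) P F (fun vs x => orthto vs x).
- by move=> vs ws x; exact: orthto_cat.
- move=> n vs.
  have [x [xvs x0 xs]] := gap_interpolate (radjP bS) (as_ n) (sb n) lo hi vs.
  by exists x.
have ss0 x : inner (S x) (S x) = (sq (S x : realH))%:C.
  by rewrite -sqr_norm_inner normE -nr_sq rmorphXn.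
have s0 x : inner x x = (sq (x : realH))%:C.
  by rewrite -sqr_norm_inner normE -nr_sq rmorphXn.
have zo i n : (i < n)%N -> inner (z n) (z i) = 0 /\ inner (z n) (SS (z i)) = 0.
  move=> /zF h; split; apply: inner_eq0; apply: h; rewrite !inE eqxx ?orbT //.
(* [w n] is the defect of [z n] as an eigenvector of [S^*S]. Orthogonality to the [w n] lets the
   form of [S^*S] on [L] treat [z n] as an eigenvector; the second half of [A] confines [L] to the
   closed span of the [z n]. *)
pose w n : H := SS (z n) - (s n)%:C *: (z n : H).
pose A := [set w n | n in setT] `|` [set y | forall n, inner y (z n) = 0].
pose L := ortho A.
have SSC x y : inner x (SS y) = (inner y (SS x))^*.
  by rewrite /SS -!adjointP // -inner_conj.
have zw k n : inner (z k) (w n) = 0.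
  rewrite /w innerBr innerZr_real.
  have [kn|nk|->] := ltngtP k n.
  - have [h1 h2] := zo _ _ kn.
    rewrite SSC h2 [inner (z k) (z n)]inner_conj h1 !rmorph0 mulr0 subr0 //.
  - by have [-> ->] := zo _ _ nk; rewrite mulr0 subr0.
  - rewrite -adjointP // ss0 s0; have [_ /= ->] := zP n.
    by rewrite rmorphM subrr.
have Lz k : L (z k).
  by move=> y [[n _ <-]|hy]; [exact: zw|rewrite inner_conj hy rmorph0].
have hL := ortho_subspace A.
have [|x [Lx x1 xo]] := AN L hL (@ortho_closed A).
  by exists (z 0%N); [exact: Lz|case: (zP 0%N)].
move: xo; set o := opnorm_on S L => xo.
have on y : L y -> nr (S y) <= o * nr y by move=> Ly; exact: opnorm_onP.
have o0 : 0 <= o by rewrite -xo -/(nr _) nr_ge0.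
have os n : s n < o ^+ 2.
  apply: (lt_le_trans (sS n)).
  have [z0 zs] := zP n.+1.
  have sz : 0 < sq (z n.+1) by exact: ip_gt0.
  rewrite -(ler_pM2r sz) -zs; apply: le_sq => //; exact: on.
pose B (u v : @realH R H) := o ^+ 2 * ip u v - ip (rlin S u) (rlin S v).
have [C C0 SC] := bounded_sq bS.
have hB : symform B.
  split; rewrite /B.
  - by move=> u v; rewrite ipC (ipC (rlin S u)).
  - by move=> u v t; rewrite linearD !ipDl; ring.
  - by move=> t u v; rewrite (linearZ_LR (rlin S)) !ipZl; ring.
  - exists (o ^+ 2) => [|u]; first exact: sqr_ge0.
    by rewrite gerBl; exact: (@sq_ge0 R realH (S u)).
have hL' : @is_subspace R (@realH R H) L.
  have [L0 LZ] := hL; split=> //.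
    by move=> u v Lu Lv; have := LZ 1 _ _ Lu Lv; rewrite scale1r.
  by move=> t u Lu; have := LZ t%:C _ _ Lu L0; rewrite addr0.
have Bp : psd B L.
  move=> u Lu; rewrite /B subr_ge0; apply: le_sq => //; exact: on.
have Bx : B x x = 0.
  by rewrite /B /= !reipE [nr (S x)]xo /nr x1 /= expr1n mulr1 subrr.
(* The null vector [x] of the semidefinite form [B] lies in its kernel; paired with [c *: z n] this
   reads [(o^2 - s n) Re <x, c z_n> = 0]. *)
have xz n : inner x (z n) = 0.
  have key (c : R[i]) : reip x (c *: (z n : H)) = 0.
    have Lc : L (c *: (z n : H)).
      by rewrite -[_ *: _]addr0; apply: hL.2; [exact: Lz|exact: hL.1].
    have := psd_ker hB hL' Bp Lx Lc Bx; rewrite /B /=.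
    have -> : reip (S x) (S (c *: (z n : H))) = s n * reip x (c *: (z n : H)).
      rewrite /reip adjointP // -/(SS _).
      have -> : SS (c *: (z n : H)) = c *: w n + (s n)%:C *: (c *: (z n : H)).
        rewrite /SS linearZ_LR adjointZ // -/(SS _) /w scalerBr !scalerA.
        by rewrite [(s n)%:C * c]mulrC subrK.
      rewrite innerDr [inner x (c *: w n)]innerZr (Lx (w n)); last first.
        by left; exists n.
      rewrite mulr0 add0r innerZr_real.
      by case: (inner x _) => p q /=; rewrite mul0r subr0.
    rewrite -mulrBl => /eqP; rewrite mulf_eq0 subr_eq0 gt_eqF //= => /eqP //.
  by apply: inner_eq0; [have := key 1; rewrite scale1r|exact: key].
(* Being orthogonal to all [z n], [x] belongs to [A], to which every element of [L] is
   orthogonal. *)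
have : inner x x = 0 by apply: Lx; right.
rewrite -sqr_norm_inner x1 expr1n => /eqP; by rewrite oner_eq0.
Qed.

End BoundedOperators.

(** * Essential bounds and comparison of the kernels *)

Section Main.
Context {R : realType} {H : hilbertType R}.
Implicit Types (x y z : H) (T S : {linear H -> H}).
Local Open Scope complex_scope.
Local Open Scope classical_set_scope.

Lemma opnorm_subP T S (e : R) x : bounded_operator T -> bounded_operator S ->
  opnorm (T \- S) < e -> nr (T x - S x) <= e * nr x.
Proof.
move=> bT bS /ltW he.
have bTS : bounded_operator (T \- S).
  have [C C0 hC] := bounded_nr bT; have [D D0 hD] := bounded_nr bS.
  apply/linear_boundedP; exists (C + D)%:C; split.
    by apply/complex_realP; exists (C + D).
  move=> M CM y; rewrite /= normE; apply: le_trans (ler_wpM2r _ (ltW CM)) => //.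
  rewrite normE -rmorphM lecR mulrDl; apply: (le_trans (nr_triangle _ _)).
  rewrite lerD // {1}/nr normrN; exact: hD.
have := @opnorm_onP R H (T \- S) setT x bTS.
move=> /(_ _ I) h; apply: (le_trans (h _)) => //.
by rewrite ler_wpM2r ?nr_ge0.
Qed.

Lemma nr_lt_sq x y (c : R) : 0 <= c ->
  (nr x < c * nr y) = (sq (x : realH) < c ^+ 2 * sq (y : realH)).
Proof.
move=> c0; rewrite -!nr_sq -exprMn ltr_pXn2r // nnegrE ?mulr_ge0 ?nr_ge0 //.
Qed.

Lemma nr_gt_sq x y (c : R) : 0 <= c ->
  (c * nr y < nr x) = (c ^+ 2 * sq (y : realH) < sq (x : realH)).
Proof.
move=> c0; rewrite -!nr_sq -exprMn ltr_pXn2r // nnegrE ?mulr_ge0 ?nr_ge0 //.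
Qed.

(** Perturbation in operator norm acts on norms, not on their squares, hence the square roots [p]
    and [q]. An AN operator within a third of [q - p] of [T] still has a gap. *)
Lemma AN_closure_no_gap T (a b : R) : AN_closure T -> 0 <= a -> a < b ->
  (forall vs, exists x : realH, orthto vs x /\ sq (rlin T x) < a * sq x) ->
  (forall vs, exists x : realH, orthto vs x /\ b * sq x < sq (rlin T x)) ->
    False.
Proof.
move=> [bT hT] a0 ab lo hi.
have b0 : 0 <= b by lra.
pose p := Num.sqrt a; pose q := Num.sqrt b.
have pq : p < q by rewrite ltr_sqrt //; lra.
have p0 : 0 <= p by exact: sqrtr_ge0.
have pa : p ^+ 2 = a by exact: sqr_sqrtr.
have qb : q ^+ 2 = b by exact: sqr_sqrtr.
clearbody p q.
pose d := (q - p) / 3; have d0 : 0 < d by rewrite /d; lra.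
have [S SAN TS] := hT d d0; have [bS _] := SAN.
have TSx x : nr (T x - S x) <= d * nr x by exact: opnorm_subP.
apply: (@AN_no_gap R H S ((p + d) ^+ 2) ((q - d) ^+ 2) SAN).
- by rewrite ltrXn2r // ?nnegrE /d; lra.
- move=> vs; have [x [xvs]] := lo vs; rewrite -pa -nr_lt_sq // => hx.
  exists x; split=> //; rewrite -nr_lt_sq; last by lra.
  have -> : S x = T x + - (T x - S x) by rewrite opprB addrC subrK.
  apply: (le_lt_trans (nr_triangle _ _)); rewrite mulrDl.
  by apply: ltr_leD => //; rewrite /nr normrN; exact: TSx.
- move=> vs; have [x [xvs]] := hi vs; rewrite -qb -nr_gt_sq //; last by lra.
  move=> hx; exists x; split=> //; rewrite -nr_gt_sq; last by rewrite /d; lra.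
  have : nr (T x) <= nr (T x - S x) + nr (S x).
    by rewrite -{1}[T x](subrK (S x)) nr_triangle.
  have := TSx x; lra.
Qed.

(** [g] is the infimum of the upper bounds of [|T x|^2 / |x|^2] in finite codimension. If the lower
    estimate failed for [e], there would be low directions under [g - e] and, by minimality, high
    ones above [g - e / 2]: a gap. *)
Lemma AN_closure_essential T : AN_closure T -> exists2 g : R, 0 <= g &
  forall e : R, 0 < e ->
    exists vs : seq (@realH R H), forall x : realH, orthto vs x ->
  (g - e) * sq x <= sq (rlin T x) /\ sq (rlin T x) <= (g + e) * sq x.
Proof.
move=> hT; have [bT _] := hT; have [C C0 TC] := bounded_sq bT.
pose G := [set b : R | 0 <= b /\ exists vs : seq (@realH R H),
  forall x : realH, orthto vs x -> sq (rlin T x) <= b * sq x].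
have Gi : has_inf G.
  split; last by exists 0 => b [].
  by exists C; split=> //; exists [::] => x _; exact: TC.
have g0 : 0 <= inf G by apply: lb_le_inf; [case: Gi|move=> b []].
exists (inf G) => // e e0.
have [b [b0 [vs hvs]] bg] := inf_adherent e0 Gi.
suff [ws hws] : exists ws : seq (@realH R H), forall x : realH, orthto ws x ->
    (inf G - e) * sq x <= sq (rlin T x).
  exists (vs ++ ws) => x /orthto_cat[/hvs h1 /hws h2]; split=> //.
  by apply: (le_trans h1); rewrite ler_wpM2r ?sq_ge0 // ltW.
apply: contrapT => nws.
have lo ws : exists x : realH,
  orthto ws x /\ sq (rlin T x) < (inf G - e) * sq x.
  apply: contrapT => nx; apply: nws; exists ws => x hx.
  by rewrite leNgt; apply/negP => h; apply: nx; exists x.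
have ge : 0 <= inf G - e.
  have [x [_ hx]] := lo [::]; rewrite leNgt; apply/negP => h.
  have := sq_ge0 (rlin T x); have := sq_ge0 (x : @realH R H); nra.
apply: (@AN_closure_no_gap T (inf G - e) (inf G - e / 2) hT ge _ lo);
  first by lra.
move=> ws; apply: contrapT => nx.
have : G (inf G - e / 2).
  split; first by lra.
  exists ws => x hx; rewrite leNgt; apply/negP => h; apply: nx; by exists x.
move=> /(ge_inf Gi.2); lra.
Qed.

Lemma orthogonal_overflow (a : nat -> H) n (Y : seq H) :
  (forall i, (i <= n)%N -> a i != 0) ->
  (forall i j, (i <= n)%N -> (j <= n)%N -> i != j -> inner (a i) (a j) = 0) ->
  size Y = n ->
  exists z, [/\ z != 0, forall v, v \in Y -> inner z v = 0 &
    forall u, (forall i, (i <= n)%N -> inner (a i) u = 0) -> inner z u = 0].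
Proof.
move=> a0 ao Yn.
have [j [m [c [c0 jm hc]]]] :=
  kernel_row (fun i (k : 'I_n) => inner (a i) (nth 0 Y k)).
pose z := \sum_(i < m.+1) c i *: a (j + i)%N.
have zE u : inner z u = \sum_(i < m.+1) c i * inner (a (j + i)%N) u.
  rewrite /z (big_morph (fun v => inner v u) (fun v w => innerDl v w u)
    (linear0l _ u)).
  by apply: eq_bigr => i _; rewrite innerZl.
have jin (i : 'I_m.+1) : (j + i <= n)%N by rewrite -jm leq_add2l -ltnS.
have jn : (j <= n)%N by rewrite -jm leq_addr.
exists z; split.
- apply: contraNneq (a0 j jn) => z0.
  have : inner z (a j) = 0 by rewrite z0 linear0l.
  rewrite zE big_ord_recl addn0 big1 ?addr0 => [|i _].
    move=> /eqP; rewrite mulf_eq0 (negPf c0) /= -sqr_norm_inner sqrf_eq0.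
    by rewrite normr_eq0.
  rewrite (ao _ _ (jin (lift ord0 i)) jn) ?mulr0 //.
  by rewrite -{2}[j]addn0 eqn_add2l.
- move=> v /(nthP 0)[k kY <-]; rewrite zE; rewrite Yn in kY.
  exact: (hc (Ordinal kY)).
- by move=> u hu; rewrite zE big1 // => i _; rewrite hu ?mulr0.
Qed.

(** Here [ker T] has a finite basis [B] and lies in [ker T^*]. A vector of [ker T^*] outside [ker T]
    would give, together with [B], one more orthogonal vector in [ker T^*] than [B'] has
    elements. *)
Lemma kernel_adjoint T : bounded_operator T -> star_paranormal T ->
  (exists vs : seq (@realH R H), forall x, T x = 0 ->
    orthto vs (x : @realH R H) -> x = 0) ->
  same_hilbert_dim (null_space T) (null_space (adjoint T)) ->
  forall x, adjoint T x = 0 -> T x = 0.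
Proof.
move=> bT pT [vs Tfin] [B [B' [[BT B1 Bo _] [B'T _ _ B'd] BB']]] x Tsx.
have ss v : inner v v = (nr v)%:C ^+ 2 by rewrite -sqr_norm_inner normE.
have Ts0 y : T y = 0 -> adjoint T y = 0.
  move=> Ty; have := pT y; rewrite Ty linear0 normr0 mul0r => h.
  apply/normr0_eq0/eqP; rewrite -sqrf_eq0 eq_le h; exact: exprn_ge0.
have nullT y u : T y = 0 -> inner u (adjoint T y) = 0.
  by move=> /Ts0 ->; rewrite linear0r.
(* Otherwise [size vs + 1] elements of [B] have a nontrivial combination orthogonal to [vs], which
   is zero by [Tfin], against orthonormality. *)
have Bfin : finite_set B.
  apply: contrapT => infB;
    have [X XB hX] := infinite_set_fset (size vs).+1 infB.
  pose a i := nth 0 (enum_fset X) i.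
  have aB i : (i <= size vs)%N -> B (a i).
    by move=> hi; apply: XB; apply: mem_nth; apply: leq_trans hX.
  have [j [m [c [c0 jm hc]]]] := kernel_row
    (fun i (k : 'I_(size vs)) => ip (a i : realH) (nth 0 vs k)).
  have jin (i : 'I_m.+1) : (j + i <= size vs)%N by rewrite -jm leq_add2l -ltnS.
  have jn : (j <= size vs)%N by rewrite -jm leq_addr.
  pose z : realH := \sum_(i < m.+1) c i *: (a (j + i)%N : realH).
  have zE u : ip z u = \sum_(i < m.+1) c i * ip (a (j + i)%N : realH) u.
    by rewrite ip_suml; apply: eq_bigr => i _; rewrite ipZl.
  have z0 : z = 0.
    apply: Tfin.
      have [_ hD hZ] : is_subspace (fun v : realH => T v = 0).
        split=> [|u v hu hv|t u hu]; first exact: linear0.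
          by rewrite linearD hu hv addr0.
        by rewrite [T _](linearZ_LR T) hu scaler0.
      apply: (@subspace_sum R realH (fun v => T v = 0)) => [|i].
        by split=> //; exact: linear0.
      by apply: hZ; exact/BT/aB.
    move=> v /(nthP 0)[k kvs <-]; rewrite zE; exact: (hc (Ordinal kvs)).
  have : ip z (a j : realH) = 0 by rewrite z0 ip0l.
  rewrite zE big_ord_recl addn0 big1 ?addr0 => [|i _].
    rewrite /= reipE /nr B1; last exact: aB.
    by rewrite /= expr1n mulr1 => /eqP; rewrite (negPf c0).
  rewrite /= /reip Bo ?mulr0 //; [exact: aB (jin (lift ord0 i))|exact: aB|].
  have ja := jin (lift ord0 i); move=> /eqP.
  rewrite nth_uniq ?fset_uniq ?(leq_trans _ hX) ?ltnS //.
  by rewrite -{2}[j]addn0 eqn_add2l.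
apply: contrapT => Tx.
pose N (y : @realH R H) := T y = 0.
have Nsub : is_subspace N.
  split=> [|u v hu hv|t u hu]; rewrite /N; first exact: linear0.
    by rewrite linearD hu hv addr0.
  by rewrite [T _](linearZ_LR T) hu scaler0.
have [C C0 TC] := bounded_sq bT.
have Ncl : sqclosed N.
  move=> y hy; apply: (@sq_eq0 R realH).
  suff -> : sq (T y : realH) = 0 by [].
  apply: (@sqclosed_zero R realH (fun y => sq (T y : realH)) C) => //.
  - by move=> u; exact: sq_ge0.
  - move=> u v /= hv; have Tv : T v = 0 by apply: (@sq_eq0 R realH);
    rewrite le_eqVlt; apply/orP; left; exact/eqP.
    have -> : T u = T (u - v) by rewrite linearB Tv subr0.
    exact: TC.
  - by move=> e /hy[v Nv yv]; exists v => //; rewrite Nv sq0.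
have [|||||p Np hp] := @riesz_coercive R (@realH R H) (@ip R realH) N
  (fun u => ip (x : realH) u) (sq (x : realH)) _ (@ip_symform R realH) Nsub Ncl.
- exact: sq_ge0.
- by exists 1 => // u _; rewrite mul1r.
- by move=> u v; rewrite (sfDr (@ip_symform R realH)).
- by move=> t u; rewrite (sfZr (@ip_symform R realH)).
- by move=> u _; exact: CS.
(* [p] is the projection of [x] onto [ker T]; since [p] is in [ker T^*] too, so is [w]. *)
pose w : H := x - p.
have w0 : w != 0 by rewrite subr_eq0; apply: contra_not_neq Tx => ->.
have wN y : T y = 0 -> inner w y = 0.
  have key u : T u = 0 -> reip w u = 0.
    move=> Nu; have := hp u Nu; rewrite /= /w => h.
    by rewrite reipDl -scaleN1r [reip (-1 *: p) u](reipZl (-1)); lra.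
  move=> Ty; apply: inner_eq0; first exact: key.
  by apply: key; rewrite linearZ_LR Ty scaler0.
have wT u : inner w (T u) = 0.
  rewrite inner_conj adjointP // /w -scaleN1r adjointD // adjointZ // Tsx.
  by rewrite (Ts0 p Np) scaler0 addr0 linear0r rmorph0.
have /finite_setP[n Bn] := Bfin.
have B'n : (B' #= `I_n)%card by apply: card_eq_trans Bn; rewrite card_eq_sym.
have B'fin : finite_set B' by apply/finite_setP; exists n.
have Xn := card_fset_set Bn; have Yn := card_fset_set B'n.
pose X := enum_fset (fset_set B); pose Y := enum_fset (fset_set B').
have XB v : v \in X -> B v by rewrite in_fset_set // => /set_mem.
pose a i := if i is k.+1 then nth 0 X k else w.
have aB k : (k < n)%N -> B (nth 0 X k).
  by move=> hk; apply: XB; apply: mem_nth; rewrite -Xn in hk.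
have [||z [z0 zY zT]] := @orthogonal_overflow a n Y _ _ Yn.
- move=> [|k] //= hk; apply: contraTneq (oner_neq0 R[i]) => h.
  by rewrite -(B1 _ (aB k hk)) h normr0 eqxx.
- move=> [|k] [|l] //= hk hl.
  + by move=> _; apply/wN/BT/aB.
  + by move=> _; rewrite inner_conj wN ?rmorph0 //; exact/BT/aB.
  + rewrite eqSS => kl; apply: Bo; [exact: aB|exact: aB|].
    by apply/eqP; rewrite nth_uniq ?fset_uniq ?Xn.
(* All [a i] are orthogonal to the range of [T], hence so is [z]. Thus [z] is in [ker T^*], inside
   the closed span of [B'], to which it is orthogonal. *)
have Tz u : inner z (T u) = 0.
  apply: zT => -[|k] //= hk.
  by rewrite inner_conj adjointP // nullT ?rmorph0 //; exact/BT/aB.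
have Tsz : adjoint T z = 0.
  by apply: inner_nondeg => u;
    rewrite -adjointP // inner_conj Tz rmorph0 linear0r.
case/eqP: z0; apply: (@sq_eq0 R realH).
suff -> : sq (z : realH) = 0 by [].
apply: (@sqclosed_orth R realH z z) => e e0.
have [y [k [v [c [vB' ->]]]] zy] := closure_sq (B'd z Tsz) e0.
exists (\sum_(i < k) c i *: v i : H) => //.
rewrite /= /reip.
rewrite (big_morph (fun y => inner y z) (fun v w => innerDl v w z) (linear0l _
  z)).
rewrite big1 // => i _; rewrite innerZl inner_conj zY ?rmorph0 ?mulr0 //.
by rewrite in_fset_set // mem_set.
Qed.

End Main.

Theorem corollary2p21 (R : realType) (H : hilbertType R)
    (T : {linear H -> H}) :
  infinite_dimensional H ->
  AN_closure T ->
  star_paranormal T ->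
  same_hilbert_dim (null_space T) (null_space (adjoint T)) ->
  normal_operator T.
Proof.
move=> _ hT pT dims; have [bT _] := hT.
have [C C0 TC] := bounded_sq bT.
have [g g0 ess] := AN_closure_essential hT.
move=> x.
apply: (@star_paranormal_normal R realH (rlin T) (radj bT) C (radjP bT) C0 TC
  _ g g0 ess).
- move=> y; have := pT y; rewrite !normE -rmorphXn -rmorphM lecR => h.
  have : (nr (adjoint T y) ^+ 2) ^+ 2 <= (nr (T (T y)) * nr y) ^+ 2.
    by rewrite ler_sqr // nnegrE ?mulr_ge0 ?nr_ge0 ?sqr_ge0.
  by rewrite (exprMn _ (nr (T (T y)))) !nr_sq.
- move=> gt0; apply: (kernel_adjoint bT pT _ dims).
  (* With [e = g / 2], [T] is bounded below in finite codimension, so its kernel is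
     finite-dimensional. *)
  have [|vs hvs] := ess (g / 2); first by rewrite divr_gt0.
  exists vs => y Ty /hvs[h _]; apply: (@sq_eq0 R realH).
  move: h; rewrite /rlin real_linearE Ty sq0; have := sq_ge0 (y : @realH R H);
    nra.
Qed.
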